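(* Let $-1\le\alpha<\beta\le1$ with $\beta^2\ge\alpha^2$ and let $B_{\alpha\beta}=\{x\in\mathbb{R}^n:\|x\|\le1,\ \alpha\le x_1\le\beta\}$. Each of the extremal ellipsoids $\mathrm{CE}(B_{\alpha\beta})$ and $\mathrm{IE}(B_{\alpha\beta})$ has the form $E(X,c)$ where $c=\tau e_1$ and $X=\mathrm{diag}(a,b,\ldots,b)$ for some $a>0$, $b>0$ and $\tau\in\mathbb{R}$ (depending on the ellipsoid). Moreover, if $\alpha=-\beta$, then $c=0$.
   Context: For a symmetric positive definite $n\times n$ matrix $X$ and $c\in\mathbb{R}^n$, $E(X,c)=\{x\in\mathbb{R}^n:\langle X(x-c),x-c\rangle\le 1\}$. For a convex body $K\subset\mathbb{R}^n$ (compact convex set with nonempty interior), $\mathrm{CE}(K)$ is the unique ellipsoid of minimum volume containing $K$ and $\mathrm{IE}(K)$ is the unique ellipsoid of maximum volume contained in $K$. $e_1=(1,0,\ldots,0)^T$. *)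

(* Defs.v *)
From mathcomp Require Import all_boot all_order all_algebra.
From mathcomp Require Import all_classical all_reals all_analysis.

Set Implicit Arguments.
Unset Strict Implicit.
Unset Printing Implicit Defensive.

Import Order.TTheory GRing.Theory Num.Theory.

Local Open Scope classical_set_scope.
Local Open Scope ring_scope.

Definition dot (R : realType) (n : nat) (u v : 'cV[R]_n) : R :=
  \sum_(i < n) u i 0 * v i 0.

(* The norm that MathComp-Analysis puts on matrices is the sup norm. *)
Definition enorm (R : realType) (n : nat) (u : 'cV[R]_n) : R :=
  Num.sqrt (dot u u).

Definition box (R : realType) (n : nat) (a b : 'cV[R]_n) : set 'cV[R]_n :=
  [set x | forall i, a i 0 <= x i 0 <= b i 0].

(* n-dimensional Lebesgue outer measure: the infimum of the total volume of a
   countable cover by boxes.  On measurable sets, in particular on ellipsoids,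
   it is the Lebesgue measure. *)
Definition volume (R : realType) (n : nat) (A : set 'cV[R]_n) : \bar R :=
  ereal_inf [set v : \bar R | exists a b : nat -> 'cV[R]_n,
    [/\ forall k i, a k i 0 <= b k i 0,
        A `<=` \bigcup_k box (a k) (b k) &
        v = (\sum_(0 <= k <oo) (\prod_(i < n) (b k i 0 - a k i 0))%:E)%E]].

Definition posdefmx (R : realType) (n : nat) (X : 'M[R]_n) : Prop :=
  X^T = X /\ forall x : 'cV[R]_n, x != 0 -> 0 < dot (X *m x) x.

Definition ellipsoid (R : realType) (n : nat) (X : 'M[R]_n) (c : 'cV[R]_n) :
    set 'cV[R]_n :=
  [set x | dot (X *m (x - c)) (x - c) <= 1].

Definition is_ellipsoid (R : realType) (n : nat) (S : set 'cV[R]_n) : Prop :=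
  exists X c, posdefmx X /\ S = ellipsoid X c.

Definition min_volume_containing (R : realType) (n : nat)
    (K S : set 'cV[R]_n) : Prop :=
  [/\ is_ellipsoid S, K `<=` S &
      forall T, is_ellipsoid T -> K `<=` T -> (volume S <= volume T)%E].

Definition max_volume_contained (R : realType) (n : nat)
    (K S : set 'cV[R]_n) : Prop :=
  [/\ is_ellipsoid S, S `<=` K &
      forall T, is_ellipsoid T -> T `<=` K -> (volume T <= volume S)%E].

(* [is_CE K S] says that CE(K) is well defined and equal to S; likewise for
   [is_IE].  Recall that [unique P S] is [P S /\ forall T, P T -> S = T]. *)
Definition is_CE (R : realType) (n : nat) (K S : set 'cV[R]_n) : Prop :=
  unique (min_volume_containing K) S.

Definition is_IE (R : realType) (n : nat) (K S : set 'cV[R]_n) : Prop :=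
  unique (max_volume_contained K) S.

(* Coordinates are numbered from 0, so x_1 is [x 0 0] and e_1 is
   [e1]; the dimension is n.+1 so that there is a first coordinate. *)
Definition e1 (R : realType) (n : nat) : 'cV[R]_n.+1 := delta_mx 0 0.

Definition slab (R : realType) (n : nat) (alpha beta : R) : set 'cV[R]_n.+1 :=
  [set x | enorm x <= 1 /\ alpha <= x 0 0 <= beta].

Definition diag_ab (R : realType) (n : nat) (a b : R) : 'M[R]_n.+1 :=
  diag_mx (\row_(i < n.+1) if i == 0 then a else b).

Arguments slab {R} n alpha beta.
Arguments e1 {R n}.
Arguments diag_ab {R n} a b.

(* Main.v *)
From HB Require Import structures.
Require Import Defs.
From mathcomp Require Import all_boot all_order all_algebra.
From mathcomp Require Import all_classical all_reals all_analysis.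
From mathcomp Require Import measurable_realfun ring lra.

(** A John-type certificate settles both optimality and uniqueness.  If contact
    points [p_i] of [K] with an ellipsoid [E(X0, c0)] carry weights with
    [sum w_i (p_i - c0) = 0] and [sum w_i (p_i - c0)(p_i - c0)^T = X0^-1], then
    averaging [<X (p_i - c), p_i - c> <= 1] gives [tr (X X0^-1) <= dim] for every
    ellipsoid [E(X, c)] containing [K], hence [det X <= det X0] by the
    arithmetic-geometric inequality, with equality only for [E(X0, c0)]; the
    inscribed case is similar, with supporting half-spaces instead of points.
    For the slab the contact points can be spread over at most two spheres
    orthogonal to [e1] and two poles, and the parameters [a], [b], [tau] solve
    explicit quadratic equations.

    Every ellipsoid is the image of the unit ball under [y |-> c + M y] with [M]
    lower triangular (Cholesky), and [M] is a product of matrices that differ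
    from the identity in one column only; such a column map multiplies the volume
    of a box by its diagonal entry, as one sees by slicing the box thinly. *)

Set Implicit Arguments.
Unset Strict Implicit.
Unset Printing Implicit Defensive.

Import Order.TTheory GRing.Theory Num.Theory.
Import numFieldNormedType.Exports.

Local Open Scope classical_set_scope.
Local Open Scope ring_scope.

(** * Volume under affine maps *)

Lemma box_inj (R : realType) (n : nat) (a b a' b' : 'cV[R]_n) :
  (forall i, a i 0 <= b i 0) -> (forall i, a' i 0 <= b' i 0) ->
  box a b = box a' b' -> a = a' /\ b = b'.
Proof.
move=> ab ab' E.
have Ha : box a' b' a by rewrite -E => i; rewrite lexx ab.
have Hb : box a' b' b by rewrite -E => i; rewrite lexx ab.
have Ha' : box a b a' by rewrite E => i; rewrite lexx ab'.
have Hb' : box a b b' by rewrite E => i; rewrite lexx ab'.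
split; apply/colP => i; apply/eqP; rewrite eq_le.
  by case/andP: (Ha i) => -> _; case/andP: (Ha' i) => -> _.
by case/andP: (Hb i) => _ ->; case/andP: (Hb' i) => _ ->.
Qed.

(** The infimum of the empty set is [+oo], so every set that is not a nonempty box has infinite
    content and only box covers count in [mu_ext]. *)
Definition box_content (R : realType) (n : nat) (B : set 'cV[R]_n) : \bar R :=
  ereal_inf [set v : \bar R | exists a b : 'cV[R]_n,
    [/\ forall i, a i 0 <= b i 0, B = box a b &
        v = (\prod_(i < n) (b i 0 - a i 0))%:E]].

Lemma box_contentE (R : realType) (n : nat) (a b : 'cV[R]_n) :
  (forall i, a i 0 <= b i 0) ->
  box_content (box a b) = (\prod_(i < n) (b i 0 - a i 0))%:E.
Proof.
move=> ab; rewrite /box_content (_ : [set v | _] =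
    [set (\prod_(i < n) (b i 0 - a i 0))%:E]) ?ereal_inf1//.
apply/seteqP; split => [v [a' [b' [ab' E ->]]]|v ->] /=.
  by have [-> ->] := box_inj ab ab' E.
by exists a, b.
Qed.

Lemma box_content_ge0 (R : realType) (n : nat) (B : set 'cV[R]_n) :
  (0 <= box_content B)%E.
Proof.
apply: le_ereal_inf_tmp => _ [a [b [ab _ ->]]].
by rewrite lee_fin prodr_ge0// => i _; rewrite subr_ge0.
Qed.

(* Every set of the sigma-algebra generated by all sets is measurable, so
   covers by measurable sets are arbitrary covers. *)
Lemma volume_mu_ext (R : realType) (n : nat) (A : set 'cV[R]_n.+1) :
  volume A =
  @mu_ext _ (g_sigma_algebraType [set: set 'cV[R]_n.+1]) R
    (@box_content R n.+1) A.
Proof.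
apply/eqP; rewrite eq_le; apply/andP; split.
  apply: le_ereal_inf_tmp => _ [B [_ AB] <-].
  have [Boo|Bfin] := pselect (exists k, box_content (B k) = +oo%E).
    have [k Bk] := Boo.
    rewrite (eseries_pinfty _ _ Bk) ?leey// => i _.
    by rewrite gt_eqF// (lt_le_trans _ (box_content_ge0 _)).
  have H k : exists ab : 'cV[R]_n.+1 * 'cV[R]_n.+1,
      (forall i, ab.1 i 0 <= ab.2 i 0) /\ B k = box ab.1 ab.2.
    apply: contrapT => Nab; apply: Bfin; exists k.
    rewrite /box_content (_ : [set v | _] = set0) ?ereal_inf0//.
    by rewrite -subset0 => v [a [b [ab E _]]]; apply: Nab; exists (a, b).
  have [f Hf] := choice H.
  apply: ereal_inf_lbound; exists (fun k => (f k).1), (fun k => (f k).2); split.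
  - by move=> k i; exact: (Hf k).1.
  - by move=> x /AB [k _ Bx]; exists k => //; rewrite -(Hf k).2.
  - by apply: eq_eseriesr => k _; rewrite (Hf k).2 box_contentE//; exact: (Hf k).1.
apply: le_ereal_inf_tmp => _ [a [b [ab Aab ->]]].
apply: ereal_inf_lbound; exists (fun k => box (a k) (b k)).
  by split => // k; exact: sub_sigma_algebra.
by apply: eq_eseriesr => k _; rewrite box_contentE.
Qed.

Lemma le_volume (R : realType) (n : nat) (A B : set 'cV[R]_n.+1) :
  A `<=` B -> (volume A <= volume B)%E.
Proof. by rewrite !volume_mu_ext => AB; exact: le_mu_ext. Qed.

Lemma volume_ge0 (R : realType) (n : nat) (A : set 'cV[R]_n.+1) :
  (0 <= volume A)%E.
Proof. by rewrite volume_mu_ext; apply: mu_ext_ge0; exact: box_content_ge0. Qed.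

Lemma volume_sigma_subadditive (R : realType) (n : nat) :
  sigma_subadditive (@volume R n.+1).
Proof.
move=> F; rewrite volume_mu_ext.
under eq_eseriesr do rewrite volume_mu_ext.
exact: (@mu_ext_sigma_subadditive _ (g_sigma_algebraType [set: set 'cV[R]_n.+1])
  R _ (@box_content_ge0 R n.+1)).
Qed.

Lemma volume_box_le (R : realType) (n : nat) (a b : 'cV[R]_n.+1) :
  (forall i, a i 0 <= b i 0) ->
  (volume (box a b) <= (\prod_(i < n.+1) (b i 0 - a i 0))%:E)%E.
Proof.
move=> ab; apply: ereal_inf_lbound.
(* The cover is padded with the degenerate box at [a], of volume 0 because there is at least one
   coordinate. *)
exists (fun=> a), (fun k => if k is 0 then b else a); split.
- by move=> [|k] i.
- by move=> x xB; exists 0%N.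
- rewrite nneseries_recl//=; last first.
    by move=> [|k] _; rewrite lee_fin prodr_ge0// => i _; rewrite subr_ge0// subrr.
  rewrite eseries_cond/= eseries0 ?adde0// => -[|k]//= _ _.
  by rewrite big_ord_recl subrr mul0r.
Qed.

Lemma volume_set0 (R : realType) (n : nat) : volume (@set0 'cV[R]_n.+1) = 0.
Proof.
apply/eqP; rewrite eq_le volume_ge0 andbT.
apply: (@le_trans _ _ (volume (box (0 : 'cV[R]_n.+1) 0))); first exact: le_volume.
apply: le_trans (volume_box_le _) _ => //.
by rewrite big_ord_recl subrr mul0r.
Qed.

(** This gives access to [outer_measure_subadditive] for finite covers by slices. *)
HB.instance Definition _ (R : realType) (n : nat) :=
  isOuterMeasure.Build R 'cV[R]_n.+1 (@volume R n.+1)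
    (volume_set0 R n) (@volume_ge0 R n) (@le_volume R n)
    (@volume_sigma_subadditive R n).

(** Multiplication by the identity matrix with column [j] replaced by [u]. *)
Definition col_map (R : realType) (n : nat) (j : 'I_n) (u x : 'cV[R]_n) :
    'cV[R]_n :=
  \col_i (if i == j then u j 0 * x j 0 else x i 0 + u i 0 * x j 0).

Lemma grid_cell (R : realFieldType) (h t : R) (m : nat) :
  0 <= t <= m.+1%:R * h ->
  exists2 l, (l < m.+1)%N & l%:R * h <= t <= l.+1%:R * h.
Proof.
elim: m => [|m IH] /andP[t0 tm]; first by exists 0%N => //; rewrite mul0r t0.
have [tm'|/ltW tm'] := leP t (m.+1%:R * h).
  have [|l lm H] := IH; first by rewrite t0.
  by exists l => //; exact: ltnW.
by exists m.+1 => //; rewrite tm'.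
Qed.

(** The box is cut into [m.+1] slices of thickness [h] across direction [j]. On one slice the shift
    in coordinate [i] varies by at most [|u i| * h], so the image fits into a box enlarged by that
    much on either side. *)
Lemma volume_col_map_box_slices (R : realType) (n : nat) (j : 'I_n.+1)
    (u a b : 'cV[R]_n.+1) (m : nat) :
  (forall i, a i 0 <= b i 0) -> 0 < u j 0 ->
  (volume (col_map j u @` box a b) <=
   (u j 0 * (b j 0 - a j 0) * \prod_(i < n.+1 | i != j)
     (b i 0 - a i 0 + 2 * `|u i 0| * (b j 0 - a j 0) * m.+1%:R^-1))%:E)%E.
Proof.
move=> ab uj.
set w := b j 0 - a j 0; pose h := w / m.+1%:R.
have w0 : 0 <= w by rewrite subr_ge0.
have h0 : 0 <= h by rewrite divr_ge0.
have mh : m.+1%:R * h = w by rewrite mulrC divfK.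
pose lo l : 'cV[R]_n.+1 := \col_i (if i == j then u j 0 * (a j 0 + l%:R * h)
  else a i 0 + u i 0 * (a j 0 + l%:R * h) - `|u i 0| * h).
pose hi l : 'cV[R]_n.+1 := \col_i (if i == j then u j 0 * (a j 0 + l.+1%:R * h)
  else b i 0 + u i 0 * (a j 0 + l%:R * h) + `|u i 0| * h).
have lohi l i : lo l i 0 <= hi l i 0.
  rewrite !mxE; case: ifP => _.
    by rewrite ler_pM2l// lerD2l ler_wpM2r// ler_nat.
  have := ab i; have : 0 <= `|u i 0| * h by rewrite mulr_ge0.
  lra.
have sub : col_map j u @` box a b `<=`
    \big[setU/set0]_(l < m.+1) box (lo l) (hi l).
  move=> _ [x xab <-].
  have /andP[ajx xjb] := xab j.
  have [|l lm /andP[lt tl]] := @grid_cell _ h (x j 0 - a j 0) m.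
    by rewrite subr_ge0 ajx mh /w lerD2r.
  rewrite -(bigcup_mkord _ (fun l => box (lo l) (hi l))); exists l => //= i; rewrite !mxE.
  case: eqP => [_|/eqP ij]; first by rewrite !ler_pM2l//; lra.
  have /andP[aix xib] := xab i.
  have : `|u i 0 * (x j 0 - a j 0 - l%:R * h)| <= `|u i 0| * h.
    rewrite normrM ler_wpM2l// ger0_norm ?subr_ge0//.
    by move: tl; rewrite -natr1 mulrDl mul1r; lra.
  rewrite ler_norml => /andP[H1 H2]; apply/andP; split; lra.
apply: le_trans (le_volume sub) _.
apply: le_trans (outer_measure_subadditive
  (@volume R n.+1 : {outer_measure set 'cV[R]_n.+1 -> \bar R})
  (fun l => box (lo l) (hi l)) m.+1) _.
apply: (@le_trans _ _ (\sum_(l < m.+1)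
    (u j 0 * h * \prod_(i < n.+1 | i != j) (b i 0 - a i 0 + 2 * `|u i 0| * h))%:E)%E).
  apply: lee_sum => l _; apply: le_trans (volume_box_le (lohi l)) _.
  rewrite lee_fin (bigD1 j)//= !mxE eqxx.
  rewrite le_eqVlt; apply/orP; left; apply/eqP; congr (_ * _).
    by rewrite -natr1; ring.
  by apply: eq_bigr => i ij; rewrite !mxE (negbTE ij); ring.
rewrite sumEFin sumr_const card_ord lee_fin -mulrnAl -mulrnAr -[h *+ _]mulr_natl mh.
rewrite le_eqVlt; apply/orP; left; apply/eqP; congr (_ * _).
by apply: eq_bigr => i _; rewrite /h !mulrA.
Qed.

Lemma volume_col_map_box (R : realType) (n : nat) (j : 'I_n.+1)
    (u a b : 'cV[R]_n.+1) :
  (forall i, a i 0 <= b i 0) -> 0 < u j 0 ->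
  (volume (col_map j u @` box a b) <=
   (u j 0 * \prod_(i < n.+1) (b i 0 - a i 0))%:E)%E.
Proof.
move=> ab uj.
(* The slice bound is [p] at [1 / m.+1] and the target is [p] at 0, so continuity of [p] removes the
   excess. *)
pose p : {poly R} := (u j 0 * (b j 0 - a j 0))%:P * \prod_(i < n.+1 | i != j)
     ((b i 0 - a i 0)%:P + (2 * `|u i 0| * (b j 0 - a j 0))%:P * 'X).
have H m : (volume (col_map j u @` box a b) <= (p.[m.+1%:R^-1])%:E)%E.
  apply: le_trans (volume_col_map_box_slices m ab uj) _.
  rewrite lee_fin /p hornerM hornerC horner_prod.
  by under [in leRHS]eq_bigr do rewrite !hornerE.
have -> : u j 0 * \prod_(i < n.+1) (b i 0 - a i 0) = p.[0].
  rewrite /p hornerM hornerC horner_prod (bigD1 j)//= mulrA; congr (_ * _).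
  by apply: eq_bigr => i _; rewrite !hornerE.
move: H (volume_ge0 (col_map j u @` box a b)).
case: (volume _) => [v||] H v0.
- rewrite lee_fin.
  apply: (@cvgr_to_ge _ \oo _ _ (fun m : nat => p.[m.+1%:R^-1])).
    apply: (@cvg_comp _ _ _ (fun m : nat => m.+1%:R^-1 : R) (horner p) \oo (nbhs (0 : R))).
      exact: cvg_harmonic.
    exact: continuous_horner.
  by apply: nearW => m; have := H m; rewrite lee_fin.
- by have := H 0%N; rewrite leye_eq.
- by [].
Qed.

Lemma volume_col_map_le (R : realType) (n : nat) (j : 'I_n.+1)
    (u : 'cV[R]_n.+1) (A : set 'cV[R]_n.+1) : 0 < u j 0 ->
  (volume (col_map j u @` A) <= (u j 0)%:E * volume A)%E.
Proof.
move=> uj; rewrite -lee_pdivrMl//.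
apply: le_ereal_inf_tmp => _ [a [b [ab Aab ->]]].
rewrite lee_pdivrMl// -nneseriesZl; last first.
  by move=> k _; rewrite lee_fin prodr_ge0// => i _; rewrite subr_ge0.
apply: (@le_trans _ _ (volume (\bigcup_k (col_map j u @` box (a k) (b k))))).
  apply: le_volume => _ [x /Aab[k _ xk] <-]; exists k => //; exact: imageP.
apply: le_trans (volume_sigma_subadditive _) _.
apply: lee_nneseries => [k _ _|k _]; first exact: volume_ge0.
by rewrite -EFinM; exact: volume_col_map_box.
Qed.

(** The inverse of a column map is a column map with the inverse diagonal entry, so the upper bound
    used in both directions is an equality. *)
Lemma volume_col_map (R : realType) (n : nat) (j : 'I_n.+1)
    (u : 'cV[R]_n.+1) (A : set 'cV[R]_n.+1) : 0 < u j 0 ->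
  volume (col_map j u @` A) = ((u j 0)%:E * volume A)%E.
Proof.
move=> uj; apply/eqP; rewrite eq_le volume_col_map_le//=.
pose u' : 'cV[R]_n.+1 :=
  \col_i (if i == j then (u j 0)^-1 else - (u i 0 / u j 0)).
have u'j : 0 < u' j 0 by rewrite mxE eqxx invr_gt0.
have E : A = col_map j u' @` (col_map j u @` A).
  rewrite image_comp (_ : _ \o _ = id) ?image_id//.
  apply/funext => x; apply/colP => i; rewrite /= !mxE !eqxx.
  case: eqP => [->|_]; first by rewrite mulKf// gt_eqF.
  by field; rewrite gt_eqF.
have := volume_col_map_le (col_map j u @` A) u'j.
by rewrite -E mxE eqxx lee_pdivlMl.
Qed.

Lemma volume_shift_le (R : realType) (n : nat) (c : 'cV[R]_n.+1)
    (A : set 'cV[R]_n.+1) : (volume ((fun x => (c + x)%R) @` A) <= volume A)%E.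
Proof.
apply: le_ereal_inf_tmp => _ [a [b [ab Aab ->]]].
apply: ereal_inf_lbound; exists (fun k => c + a k), (fun k => c + b k); split.
- by move=> k i; rewrite !mxE lerD2l.
- move=> _ [x /Aab[k _ xk] <-]; exists k => // i.
  by rewrite !mxE !lerD2l.
- apply: eq_eseriesr => k _; congr (_%:E); apply: eq_bigr => i _.
  by rewrite !mxE; ring.
Qed.

Lemma volume_shift (R : realType) (n : nat) (c : 'cV[R]_n.+1)
    (A : set 'cV[R]_n.+1) : volume ((fun x => c + x) @` A) = volume A.
Proof.
apply/eqP; rewrite eq_le volume_shift_le/=.
have := volume_shift_le (- c) ((fun x => c + x) @` A).
rewrite image_comp (_ : _ \o _ = id) ?image_id//.
by apply/funext => x /=; rewrite addKr.
Qed.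

(** Runs from the identity at [k = 0] to [M] at [k = n], so that an induction can split off one
    column map at a time. *)
Definition leading_cols (R : realType) (n : nat) (k : nat) (M : 'M[R]_n) :
    'M[R]_n :=
  \matrix_(i, j) if (j < k)%N then M i j else (i == j)%:R.

(** Column [j] of a lower triangular matrix vanishes above the diagonal, where the columns taken
    earlier would act on it; hence [leading_cols j M] fixes it, which is [E]. *)
Lemma leading_colsS (R : realType) (n : nat) (j : 'I_n) (M : 'M[R]_n)
    (x : 'cV[R]_n) : is_trig_mx M ->
  leading_cols j.+1 M *m x = leading_cols j M *m col_map j (col j M) x.
Proof.
move=> /is_trig_mxP trigM; apply/colP => i; rewrite !mxE.
have E : \sum_k leading_cols j M i k * M k j = M i j.
  rewrite (bigD1 i)//= big1 => [|k ki]; rewrite !mxE.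
    case: ltnP => [ij|_]; last by rewrite eqxx mul1r addr0.
    by rewrite (trigM _ _ ij) mulr0 addr0.
  case: ltnP => [kj|_]; first by rewrite (trigM _ _ kj) mulr0.
  by rewrite eq_sym (negbTE ki) mul0r.
rewrite (bigD1 j)//= [RHS](bigD1 j)//= !mxE leqnn eqxx -{1}E (bigD1 j)//=.
rewrite mulrDl mulr_suml -addrA !mxE; congr (_ + _); first by rewrite mulrA.
rewrite -big_split; apply: eq_bigr => k kj /=.
have kj' : (k == j :> nat) = false by exact: negbTE.
have kjS : (k < j.+1)%N = (k < j)%N by rewrite ltnS leq_eqVlt kj'.
by rewrite !mxE (negbTE kj) kjS; ring.
Qed.

Lemma volume_trig_mx (R : realType) (n : nat) (M : 'M[R]_n.+1)
    (c : 'cV[R]_n.+1) (A : set 'cV[R]_n.+1) :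
  is_trig_mx M -> (forall i, 0 < M i i) ->
  volume ((fun x => c + M *m x) @` A) = ((\prod_i M i i)%:E * volume A)%E.
Proof.
move=> trigM Mpos.
rewrite -(image_comp (mulmx M) (fun x => c + x)) volume_shift.
suff H k : (k <= n.+1)%N ->
    volume (mulmx (leading_cols k M) @` A) =
    ((\prod_(i < n.+1 | (i < k)%N) M i i)%:E * volume A)%E.
  have := H _ (leqnn _); rewrite (_ : leading_cols _ _ = M).
    by move=> ->; congr (_%:E * _)%E; apply: eq_bigl => i; rewrite ltn_ord.
  by apply/matrixP => i j; rewrite !mxE ltn_ord.
elim: k A => [|k IH] A kn.
  rewrite big_pred0// mul1e (_ : leading_cols _ _ = 1%:M).
    by rewrite (_ : mulmx _ = id) ?image_id//; apply/funext => x; rewrite mul1mx.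
  by apply/matrixP => i j; rewrite !mxE.
pose j := Ordinal kn.
rewrite (_ : mulmx _ = mulmx (leading_cols k M) \o col_map j (col j M)); last first.
  by apply/funext => x; exact: (@leading_colsS _ _ j).
rewrite -image_comp IH ?(ltnW kn)// volume_col_map ?mxE//.
rewrite muleA -EFinM (bigD1 j (P := fun i => (i < k.+1)%N))//= [in RHS]mulrC.
congr (_%:E * _)%E; congr (_ * _); apply: eq_bigl => i.
by rewrite ltnS [in RHS]leq_eqVlt -(inj_eq val_inj)/=; case: ltngtP.
Qed.

(* The dimension is peeled off by integrating over the last coordinate; [P]
   records which boxes of the cover meet the current slice of the cube. *)
Lemma cube_cover_ge1 (R : realType) (n : nat) (P : pred nat)
    (a b : nat -> nat -> R) :
  (forall k i, a k i <= b k i) ->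
  (forall x : nat -> R, (forall i, 0 <= x i <= 1) ->
    exists2 k, P k & forall i, (i < n)%N -> a k i <= x i <= b k i) ->
  (1 <= \sum_(0 <= k <oo)
    (if P k then \prod_(i < n) (b k i - a k i) else 0)%:E)%E.
Proof.
move=> ab; elim: n P => [|n IH] P cov.
  (* An empty product is 1, so in dimension 0 a single selected box suffices. *)
  have [|k Pk _] := cov (fun=> 0); first by move=> i; rewrite lexx ler01.
  apply: (@le_trans _ _ (\sum_(0 <= i < k.+1)
      (if P i then \prod_(i0 < 0) (b i i0 - a i i0) else 0)%:E)%E).
    rewrite big_nat_recr//= Pk big_ord0 leeDr// sume_ge0// => i _.
    by case: ifP => _; rewrite ?big_ord0 lee_fin.
  apply: nneseries_lim_ge => i _ _.
  by case: ifP => _; rewrite ?big_ord0 lee_fin.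
pose p k := if P k then \prod_(i < n) (b k i - a k i) else 0.
have p0 k : 0 <= p k.
  by rewrite /p; case: ifP => // _; rewrite prodr_ge0// => i _; rewrite subr_ge0.
pose I k : set R := `[a k n, b k n]%classic.
have mI k : measurable (I k) by exact: measurable_itv.
pose D : set R := `[0, 1]%classic.
have mD : measurable D by exact: measurable_itv.
have mu01 : (1 <= @lebesgue_measure R D)%E.
  by rewrite lebesgue_measure_itv/= lte_fin ltr01 sube0.
pose f k (s : R) : \bar R := (p k * \1_(I k) s)%:E.
have S (s : R) : D s ->
    (1 <= \sum_(0 <= k <oo) f k s)%E.
  rewrite /D/= in_itv/= => s01.
  apply: le_trans (IH (fun k => P k && (s \in `[a k n, b k n])) _) _.
    move=> x x01.
    have [|k Pk H] := cov (fun i => if i == n then s else x i).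
      by move=> i; case: eqP.
    exists k; first by rewrite Pk in_itv/=; have := H n (leqnn _); rewrite eqxx.
    by move=> i ni; have := H i (ltnW ni); rewrite (ltn_eqF ni).
  apply: lee_nneseries => [k _ _|k _].
    by case: ifP => _; rewrite lee_fin// prodr_ge0// => i _; rewrite subr_ge0.
  rewrite /f /p indicE /I mem_setE.
  by case: (P k); case: (s \in _); rewrite /= ?mulr1 ?mulr0 ?mul0r.
have mf k : measurable_fun D (f k).
  apply/measurable_EFinP.
  exact: (measurable_funM (measurable_cst (p k)) (measurable_indic (mI k))).
have f0 k (s : R) : (0 <= f k s)%E.
  by rewrite /f lee_fin mulr_ge0// indicE.
(* The slice inequality [S] is integrated over [D] and the integral exchanged with the sum; the
   indicator of [I k] contributes at most the length of the last side. *)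
apply: (@le_trans _ _ (\int[lebesgue_measure]_(s in D)
   (\sum_(0 <= k <oo) f k s))%E).
  apply: (@le_trans _ _ (\int[@lebesgue_measure R]_(s in D) 1)%E).
    by rewrite integral_cst// mul1e; exact: mu01.
  apply: ge0_le_integral => //.
  by apply: ge0_emeasurable_sum => [k s _ _|k _]; [exact: f0|exact: mf].
have -> : (\int[@lebesgue_measure R]_(s in D) \sum_(0 <= k <oo) f k s =
    \sum_(0 <= k <oo) \int[@lebesgue_measure R]_(s in D) f k s)%E.
  exact: (integral_nneseries (@lebesgue_measure R) mD mf (fun k s _ => f0 k s)).
apply: lee_nneseries => [k _ _|k _]; first by apply: integral_ge0.
have -> : (\int[@lebesgue_measure R]_(s in D) f k s =
    (p k)%:E * \int[@lebesgue_measure R]_(s in D) (\1_(I k) s)%:E)%E.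
  apply: (@ge0_integralZl_EFin _ _ _ (@lebesgue_measure R) D mD
    (fun s => (\1_(I k) s)%:E) _ _ (p k) (p0 k)).
    by move=> s _; rewrite lee_fin indicE.
  apply/measurable_EFinP; exact: (measurable_indic (mI k)).
rewrite (integral_indic (@lebesgue_measure R) mD (mI k)).
have -> : (if P k then \prod_(i < n.+1) (b k i - a k i) else 0) =
    p k * (b k n - a k n).
  by rewrite /p; case: ifP => _; rewrite ?mul0r// big_ord_recr.
rewrite EFinM lee_pmul// ?lee_fin//.
apply: (@le_trans _ _ (@lebesgue_measure R (I k))).
  by apply: le_measure; rewrite ?inE//; [exact: (measurableI _ _ (mI k) mD)|exact: mI].
rewrite lebesgue_measure_itv/= lte_fin.
by case: ltP => _; rewrite ?lexx// lee_fin subr_ge0.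
Qed.

Lemma volume_unit_cube_ge1 (R : realType) (n : nat) :
  (1 <= volume (box (0 : 'cV[R]_n.+1) (const_mx 1%R)))%E.
Proof.
apply: le_ereal_inf_tmp => _ [a [b [ab Aab ->]]].
apply: le_trans (@cube_cover_ge1 R n.+1 xpredT (fun k i => a k (inord i) 0)
  (fun k i => b k (inord i) 0) _ _) _.
- by [].
- move=> x x01; have [|k _ H] := Aab (\col_i x i).
    by move=> i; rewrite !mxE.
  by exists k => // i ni; have := H (inord i); rewrite mxE inordK.
- rewrite le_eqVlt; apply/orP; left; apply/eqP/eq_eseriesr => k _.
  by congr (_%:E); apply: eq_bigr => i _; rewrite inord_val.
Qed.

Definition unit_ball (R : realType) (n : nat) : set 'cV[R]_n :=
  [set x | dot x x <= 1].
Arguments unit_ball {R n}.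

(** The ball lies in the cube [[-1, 1]^(n+1)] and contains the unit cube scaled by [1 / (n+1)]. A
    finite positive value can be cancelled when volumes of ellipsoids are compared. *)
Lemma volume_unit_ball (R : realType) (n : nat) :
  exists2 v : R, 0 < v & volume (@unit_ball R n.+1) = v%:E.
Proof.
have le1 : (volume (@unit_ball R n.+1) < +oo)%E.
  apply: le_lt_trans (le_volume _) (le_lt_trans
    (volume_box_le (a := const_mx (-1)) (b := const_mx 1) _) (ltry _)).
    move=> x /= x1 i; rewrite !mxE -ler_norml -ler_sqr ?nnegrE//.
    rewrite expr1n real_normK ?num_real// (le_trans _ x1)//.
    by rewrite /dot (bigD1 i)//= expr2 lerDl sumr_ge0// => k _; rewrite -expr2 sqr_ge0.
  by move=> i; rewrite !mxE; lra.
have gt0 : (0 < volume (@unit_ball R n.+1))%E.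
  pose M : 'M[R]_n.+1 := (n.+1%:R^-1)%:M.
  have trigM : is_trig_mx M by exact: scalar_mx_is_trig.
  have Mpos i : 0 < M i i by rewrite mxE eqxx invr_gt0.
  have := volume_trig_mx 0 (box (0 : 'cV[R]_n.+1) (const_mx 1)) trigM Mpos.
  move=> E; apply: (@lt_le_trans _ _ (volume
     ((fun x => 0 + M *m x) @` box (0 : 'cV[R]_n.+1) (const_mx 1)))).
    rewrite E mule_gt0 ?lte_fin ?prodr_gt0//.
    by apply: lt_le_trans (volume_unit_cube_ge1 R n); rewrite lte01.
  apply: le_volume => _ [x x01 <-]; rewrite /unit_ball/= add0r mul_scalar_mx /dot.
  apply: (@le_trans _ _ (\sum_(i < n.+1) n.+1%:R^-1)); last first.
    by rewrite sumr_const card_ord -[_^-1 *+ _]mulr_natr mulVf.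
  apply: ler_sum => i _; rewrite !mxE.
  have := x01 i; rewrite !mxE => /andP[x0 x1].
  have N0 : 0 <= n.+1%:R^-1 :> R by rewrite invr_ge0.
  have N1 : n.+1%:R^-1 <= 1 :> R by rewrite invf_le1// ler1n.
  rewrite -mulrA -[leRHS]mulr1 ler_wpM2l//.
  rewrite mulr_ile1// ?mulr_ge0// mulr_ile1//.
exists (fine (volume (@unit_ball R n.+1))); first by rewrite fine_gt0// gt0 le1.
by rewrite fineK// ge0_fin_numE// ltW.
Qed.

(** * Quadratic forms and ellipsoids *)

Lemma dotE (R : realType) (n : nat) (u v : 'cV[R]_n) : dot u v = (u^T *m v) 0 0.
Proof. by rewrite mxE; apply: eq_bigr => i _; rewrite mxE. Qed.

Lemma dotC (R : realType) (n : nat) (u v : 'cV[R]_n) : dot u v = dot v u.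
Proof. by apply: eq_bigr => i _; rewrite mulrC. Qed.

Lemma dotDl (R : realType) (n : nat) (u v w : 'cV[R]_n) :
  dot (u + v) w = dot u w + dot v w.
Proof. by rewrite -big_split; apply: eq_bigr => i _; rewrite mxE mulrDl. Qed.

Lemma dotZl (R : realType) (n : nat) (a : R) (u v : 'cV[R]_n) :
  dot (a *: u) v = a * dot u v.
Proof. by rewrite mulr_sumr; apply: eq_bigr => i _; rewrite mxE mulrA. Qed.

Lemma dotBl (R : realType) (n : nat) (u v w : 'cV[R]_n) :
  dot (u - v) w = dot u w - dot v w.
Proof. by rewrite -scaleN1r dotDl dotZl mulN1r. Qed.

Lemma dotDr (R : realType) (n : nat) (u v w : 'cV[R]_n) :
  dot u (v + w) = dot u v + dot u w.
Proof. by rewrite dotC dotDl !(dotC u). Qed.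

Lemma dotBr (R : realType) (n : nat) (u v w : 'cV[R]_n) :
  dot u (v - w) = dot u v - dot u w.
Proof. by rewrite dotC dotBl !(dotC u). Qed.

Lemma dotZr (R : realType) (n : nat) (a : R) (u v : 'cV[R]_n) :
  dot u (a *: v) = a * dot u v.
Proof. by rewrite dotC dotZl dotC. Qed.

Lemma dot0l (R : realType) (n : nat) (u : 'cV[R]_n) : dot 0 u = 0.
Proof. by rewrite -(scale0r 0) dotZl mul0r. Qed.

Lemma dot_suml (R : realType) (n : nat) (I : finType) (f : I -> 'cV[R]_n) v :
  dot (\sum_i f i) v = \sum_i dot (f i) v.
Proof.
exact: (big_morph (fun u => dot u v) (fun u w => dotDl u w v) (dot0l v)).
Qed.

Lemma dot_ge0 (R : realType) (n : nat) (u : 'cV[R]_n) : 0 <= dot u u.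
Proof. by apply: sumr_ge0 => i _; rewrite -expr2 sqr_ge0. Qed.

Lemma dot_eq0 (R : realType) (n : nat) (u : 'cV[R]_n) : dot u u = 0 -> u = 0.
Proof.
move=> /eqP; rewrite psumr_eq0 => [/allP u0|i _]; last by rewrite -expr2 sqr_ge0.
apply/colP => i; rewrite mxE; have := u0 i (mem_index_enum i).
by rewrite /= mulf_eq0 orbb => /eqP.
Qed.

Lemma dot_mull (R : realType) (m n : nat) (A : 'M[R]_(m, n)) u v :
  dot (A *m u) v = dot u (A^T *m v).
Proof. by rewrite !dotE trmx_mul mulmxA. Qed.

Lemma dot_tr (R : realType) (n : nat) (A : 'M[R]_n) (u : 'cV[R]_n) :
  dot (A *m u) u = \tr (A *m (u *m u^T)).
Proof.
rewrite mulmxA mxtrace_mulC dotC dotE /mxtrace big_ord1; congr (_ _ _).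
Qed.

Lemma enormK (R : realType) (n : nat) (u : 'cV[R]_n) :
  enorm u ^+ 2 = dot u u.
Proof. by rewrite sqr_sqrtr ?dot_ge0. Qed.

Lemma enorm_le1 (R : realType) (n : nat) (u : 'cV[R]_n) :
  (enorm u <= 1) = (dot u u <= 1).
Proof. by rewrite -enormK expr_le1// sqrtr_ge0. Qed.

Lemma dot_le_enorm (R : realType) (n : nat) (u v : 'cV[R]_n) :
  dot v v = 1 -> dot u v <= enorm u.
Proof.
move=> v1; have := dot_ge0 (u - dot u v *: v).
rewrite dotBl !dotBr !dotZl !dotZr v1 (dotC v u) => H.
apply: le_trans (ler_norm _) _.
rewrite -(ler_pXn2r (n := 2))// ?nnegrE// ?sqrtr_ge0//.
by rewrite enormK real_normK ?num_real//; lra.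
Qed.

Lemma trig_unitmx (R : realType) (n : nat) (M : 'M[R]_n) :
  is_trig_mx M -> (forall i, 0 < M i i) -> M \in unitmx.
Proof.
move=> trigM Mpos; rewrite unitmxE det_trig// unitfE gt_eqF//.
exact: prodr_gt0.
Qed.

Lemma dot_col_mx (R : realType) (m n : nat) (a c : 'cV[R]_m) (b d : 'cV[R]_n) :
  dot (col_mx a b) (col_mx c d) = dot a c + dot b d.
Proof. by rewrite !dotE tr_col_mx mul_row_col mxE. Qed.

Lemma mul_outer (R : realType) (n : nat) (u v w : 'cV[R]_n) :
  u *m v^T *m w = dot v w *: u.
Proof.
by rewrite -mulmxA [v^T *m w]mx11_scalar -dotE mul_mx_scalar.
Qed.

Lemma dot_scalar_mx (R : realType) (a b : R) :
  dot (a%:M : 'cV_1) b%:M = a * b.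
Proof. by rewrite /dot big_ord1 !mxE eqxx !mulr1n. Qed.

(** Induction on the dimension: eliminating the first row and column leaves the Schur complement
    [S], which is again positive definite. *)
Lemma cholesky (R : realType) (n : nat) (X : 'M[R]_n) : posdefmx X ->
  exists L : 'M[R]_n, [/\ is_trig_mx L, forall i, 0 < L i i & X = L *m L^T].
Proof.
elim: n X => [|n IH] X [symX posX].
  exists 0; split; [exact: mx0_is_trig|by case|by apply/matrixP => -[]].
pose X1 : 'M[R]_(1 + n) := X.
pose x := X1 0 0; pose v := dlsubmx X1; pose W := drsubmx X1.
have symX1 : X1^T = X1 by exact: symX.
have ulE : ulsubmx X1 = x%:M.
  by rewrite [LHS]mx11_scalar !mxE /x; congr (X1 _ _)%:M; apply: val_inj.
have urE : ursubmx X1 = v^T by rewrite /v trmx_dlsub symX1.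
have WT : W^T = W by rewrite /W trmx_drsub symX1.
have XE : X1 = block_mx x%:M v^T v W by rewrite -[LHS]submxK ulE urE.
have posX1 (s : R) (y : 'cV[R]_n) : (s != 0) || (y != 0) ->
    0 < s ^+ 2 * x + s * (2 * dot v y) + dot (W *m y) y.
  move=> sy; pose z : 'cV[R]_(1 + n) := col_mx s%:M y.
  have z0 : z != 0.
    apply: contraTneq sy => z0; rewrite negb_or !negbK.
    have : usubmx z = 0 by rewrite z0; apply/colP => i; rewrite !mxE.
    have : dsubmx z = 0 by rewrite z0; apply/colP => i; rewrite !mxE.
    rewrite col_mxKu col_mxKd => -> /matrixP/(_ 0 0).
    by rewrite !mxE eqxx mulr1n => ->; rewrite !eqxx.
  have : 0 < dot (X1 *m z) z := posX z z0; rewrite XE mul_block_col dot_col_mx.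
  rewrite !dotDl !mul_mx_scalar !dotZl dot_scalar_mx.
  rewrite [v^T *m y]mx11_scalar -dotE dot_scalar_mx.
  by congr (0 < _); ring.
have x0 : 0 < x.
  by have := posX1 1 0; rewrite oner_eq0 mulmx0 dot0l (dotC v) dot0l => /(_ isT); lra.
pose S := W - x^-1 *: (v *m v^T).
have [|L [trigL Lpos SE]] := IH S.
  split=> [|y y0]; first by rewrite /S linearB linearZ/= WT trmx_mul trmxK.
  (* This first coordinate minimizes the quadratic form for given [y]; the minimum is the form of
     [S] at [y]. *)
  have := posX1 (- (dot v y / x)) y; rewrite y0 orbT => /(_ isT).
  rewrite /S mulmxBl dotBl -scalemxAl dotZl mul_outer dotZl.
  by congr (0 < _); field; rewrite gt_eqF.
have sx0 : 0 < Num.sqrt x by rewrite sqrtr_gt0.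
pose L1 : 'M[R]_(1 + n) :=
  block_mx (Num.sqrt x)%:M 0 ((Num.sqrt x)^-1 *: v) L.
exists L1; split.
- change (@is_trig_mx _ (1 + n) (1 + n) L1).
  rewrite is_trig_block_mx// eqxx/= trigL andbT.
  exact: scalar_mx_is_trig.
- change (forall i : 'I_(1 + n), 0 < L1 i i) => i.
  rewrite -(splitK i); case: (fintype.split i) => j /=.
    by rewrite block_mxEul !ord1 mxE eqxx mulr1n.
  by rewrite block_mxEdr.
- change (X1 = L1 *m L1^T); rewrite XE tr_block_mx mulmx_block !trmx0 !mul0mx !mulmx0 !addr0.
  rewrite tr_scalar_mx -scalar_mxM -expr2 sqr_sqrtr ?(ltW x0)//.
  rewrite mul_scalar_mx mul_mx_scalar linearZ/= !scalerA mulfV ?gt_eqF//.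
  rewrite !scale1r -scalemxAl -scalemxAr scalerA -SE /S -invfM -expr2.
  by rewrite sqr_sqrtr ?(ltW x0)// addrC subrK.
Qed.

(** The arithmetic-geometric inequality, from [d <= expR (d - 1)], which is strict unless
    [d = 1]. *)
Lemma prod_le1_of_sum (R : realType) (n : nat) (d : 'I_n -> R) :
  (forall i, 0 < d i) -> \sum_i d i <= n%:R ->
  \prod_i d i <= 1 /\ (\prod_i d i = 1 -> forall i, d i = 1).
Proof.
move=> d0 dn.
have le_exp i : 0 <= d i <= expR (d i - 1).
  by rewrite ltW//= -[leLHS](subrKC 1) expR_ge1Dx.
have exp_le1 : \prod_i expR (d i - 1) <= 1.
  rewrite -expR_sum -[leRHS]expR0 ler_expR big_split/= sumr_const card_ord.
  by rewrite mulNrn subr_le0.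
split; first by apply: le_trans exp_le1; exact: ler_prod.
move=> d1 i; apply: contrapT => /eqP di1.
suff : \prod_i d i < 1 by rewrite d1 ltxx.
apply: lt_le_trans exp_le1; rewrite (bigD1 i)//= [ltRHS](bigD1 i)//=.
apply: (@lt_le_trans _ _ (expR (d i - 1) * \prod_(j < n | j != i) d j)).
  rewrite ltr_pM2r ?prodr_gt0// -[ltLHS](subrKC 1) expR_gt1Dx//.
  by rewrite subr_eq0.
by rewrite ler_pM2l ?expR_gt0//; exact: ler_prod.
Qed.

(** A Cholesky factor [L] takes the place of eigenvalues: the determinant is the product of the
    squared diagonal entries of [L], and the trace is the sum of the squares of all its entries. In
    the equality case nothing is left for the entries off the diagonal. *)
Lemma posdefmx_det_le1 (R : realType) (n : nat) (Z : 'M[R]_n) :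
  posdefmx Z -> \tr Z <= n%:R ->
  \det Z <= 1 /\ (\det Z = 1 -> Z = 1%:M).
Proof.
move=> /cholesky[L [trigL Lpos ->]] trL.
have dE : \det (L *m L^T) = \prod_i L i i ^+ 2.
  by rewrite det_mulmx det_tr det_trig// -expr2 prodrXl.
have trE : \tr (L *m L^T) = \sum_i (L i i ^+ 2 + \sum_(j < n | j != i) L i j ^+ 2).
  apply: eq_bigr => i _; rewrite mxE (bigD1 i)//= !mxE expr2; congr (_ + _).
  by apply: eq_bigr => j _; rewrite mxE expr2.
have off i : 0 <= \sum_(j < n | j != i) L i j ^+ 2.
  by apply: sumr_ge0 => j _; exact: sqr_ge0.
have Lpos2 i : 0 < L i i ^+ 2 by rewrite exprn_gt0.
rewrite trE big_split/= in trL.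
have [||le1 eq1] := prod_le1_of_sum (d := fun i => L i i ^+ 2) (n := n) => //.
  by apply: le_trans trL; rewrite lerDl sumr_ge0.
rewrite dE; split=> // /eq1 L1.
have {}L1 i : L i i = 1.
  by apply/eqP; rewrite -(@eqrXn2 _ 2)// ?expr1n ?L1// ltW.
suff -> : L = 1%:M by rewrite trmx1 mulmx1.
apply/matrixP => i j; rewrite mxE eq_sym; case: eqP => [->//|/eqP ji].
move: trL; under eq_bigr do rewrite L1 expr1n.
rewrite sumr_const card_ord gerDl => off0.
have {}off0 : \sum_i \sum_(j < n | j != i) L i j ^+ 2 == 0.
  by rewrite eq_le off0 sumr_ge0.
rewrite psumr_eq0// in off0; have /allP/(_ i (mem_index_enum i)) := off0.
rewrite /= psumr_eq0 => [/allP/(_ j (mem_index_enum j))|k _]; last exact: sqr_ge0.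
by rewrite ji/= sqrf_eq0 => /eqP.
Qed.

Lemma posdefmx_conj (R : realType) (n : nat) (X M : 'M[R]_n) :
  posdefmx X -> M \in unitmx -> posdefmx (M^T *m X *m M).
Proof.
move=> [symX posX] unitM; split.
  by rewrite !trmx_mul trmxK symX mulmxA.
move=> x x0; rewrite -!mulmxA dot_mull trmxK; apply: posX.
by apply: contra x0 => /eqP Mx0; rewrite -(mulKmx unitM x) Mx0 mulmx0.
Qed.

Lemma posdefmx_unit (R : realType) (n : nat) (X : 'M[R]_n) :
  posdefmx X -> X \in unitmx.
Proof.
move=> /cholesky[L [trigL Lpos ->]].
by rewrite unitmx_mul unitmx_tr !trig_unitmx.
Qed.

Lemma posdefmx_inv (R : realType) (n : nat) (X : 'M[R]_n) :
  posdefmx X -> posdefmx (invmx X).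
Proof.
move=> pX; have := posdefmx_conj pX (M := invmx X).
rewrite unitmx_inv posdefmx_unit// => /(_ isT).
by rewrite trmx_inv pX.1 mulVmx ?posdefmx_unit// mul1mx.
Qed.

(** Equivalently [X^-1 = M M^T]: the map [y |-> c + M y] carries the unit ball onto the ellipsoid,
    and triangularity makes its volume factor the product of the diagonal of [M]. *)
Definition frame (R : realType) (n : nat) (X M : 'M[R]_n) : Prop :=
  [/\ is_trig_mx M, forall i, 0 < M i i & M^T *m X *m M = 1%:M].

Lemma frame_unit (R : realType) (n : nat) (X M : 'M[R]_n) :
  frame X M -> M \in unitmx.
Proof. by case=> trigM Mpos _; exact: trig_unitmx. Qed.

Lemma frame_ellipsoid (R : realType) (n : nat) (X M : 'M[R]_n) :
  frame X M -> forall c : 'cV[R]_n,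
  ellipsoid X c = (fun y => c + M *m y) @` unit_ball.
Proof.
move=> fM c; have uM := frame_unit fM; have [_ _ E] := fM.
have dotM y : dot (X *m (M *m y)) (M *m y) = dot y y.
  have -> : dot y y = dot (1%:M *m y) y by rewrite mul1mx.
  by rewrite -E -!mulmxA [RHS]dot_mull trmxK.
apply/seteqP; split => [x xE|_ [y yB <-]]; last first.
  by rewrite /ellipsoid/= addrC addKr dotM.
exists (invmx M *m (x - c)); last by rewrite mulKVmx// subrKC.
by rewrite /unit_ball/= -dotM mulKVmx.
Qed.

Lemma frame_det (R : realType) (n : nat) (X M : 'M[R]_n) : frame X M ->
  \det X * (\prod_i M i i) ^+ 2 = 1.
Proof.
case=> trigM _ /(congr1 determinant).
rewrite !det_mulmx det_tr det1 (det_trig trigM) => E.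
by rewrite -[RHS]E; ring.
Qed.

Lemma frame_inj (R : realType) (n : nat) (X X' M : 'M[R]_n) :
  frame X M -> frame X' M -> X = X'.
Proof.
move=> fM fM'; have uM := frame_unit fM.
have uMT : M^T \in unitmx by rewrite unitmx_tr.
case: fM fM' => _ _ E [_ _]; rewrite -E.
by move/(can_inj (mulmxK uM))/(can_inj (mulKmx uMT)).
Qed.

Lemma frame_exists (R : realType) (n : nat) (X : 'M[R]_n) :
  posdefmx X -> exists M, frame X M.
Proof.
move=> pX; have [M [trigM Mpos ME]] := cholesky (posdefmx_inv pX).
exists M; split => //; rewrite -mulmxA; apply: mulmx1C.
by rewrite -mulmxA -ME mulmxV// posdefmx_unit.
Qed.

(** * Optimality certificates *)

Lemma le_volume_ellipsoid (R : realType) (n : nat) (X X' M M' : 'M[R]_n.+1)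
    (c c' : 'cV[R]_n.+1) : frame X M -> frame X' M' ->
  (volume (ellipsoid X c) <= volume (ellipsoid X' c'))%E =
  (\prod_i M i i <= \prod_i M' i i).
Proof.
move=> fM fM'; rewrite (frame_ellipsoid fM) (frame_ellipsoid fM').
case: fM fM' => [trigM Mpos _] [trigM' Mpos' _].
rewrite !volume_trig_mx//; have [v v0 ->] := volume_unit_ball R n.
by rewrite -!EFinM lee_fin ler_pM2r.
Qed.

Lemma CE_certificate (R : realType) (n : nat) (K : set 'cV[R]_n.+1)
    (I : finType) (w : I -> R) (p : I -> 'cV[R]_n.+1)
    (X0 : 'M[R]_n.+1) (c0 : 'cV[R]_n.+1) :
  posdefmx X0 -> K `<=` ellipsoid X0 c0 ->
  (forall i, 0 <= w i) -> (forall i, K (p i)) ->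
  \sum_i w i = n.+1%:R ->
  \sum_i w i *: (p i - c0) = 0 ->
  X0 *m (\sum_i w i *: ((p i - c0) *m (p i - c0)^T)) = 1%:M ->
  is_CE K (ellipsoid X0 c0).
Proof.
move=> pX0 KE0 w0 Kp wN m1 m2.
have [M0 fM0] := frame_exists pX0.
set Y := \sum_i w i *: _ in m2.
have YE : Y = M0 *m M0^T.
  have [_ _ /mulmx1C] := fM0; rewrite mulmxA => E.
  by rewrite -[LHS]mul1mx -E -(mulmxA _ X0 Y) m2 mulmx1.
(* Averaging the inequality [<X(p i - c), p i - c> <= 1] with weights [w]. *)
have key X c : posdefmx X -> K `<=` ellipsoid X c ->
    \tr (M0^T *m X *m M0) + n.+1%:R * dot (X *m (c - c0)) (c - c0) <= n.+1%:R.
  move=> pX KE.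
  have E i : dot (X *m (p i - c)) (p i - c) =
      dot (X *m (p i - c0)) (p i - c0) - 2 * dot (p i - c0) (X *m (c - c0))
      + dot (X *m (c - c0)) (c - c0).
    have -> : p i - c = (p i - c0) - (c - c0) by rewrite opprB addrA subrK.
    move: (p i - c0) (c - c0) => z y.
    by rewrite mulmxBr !(dotBl, dotBr) (dot_mull _ z y) pX.1 (dotC (X *m y) z); ring.
  have : \sum_i w i * dot (X *m (p i - c)) (p i - c) <= n.+1%:R.
    rewrite -wN; apply: ler_sum => i _; rewrite -[leRHS]mulr1 ler_wpM2l//.
    exact/KE/Kp.
  apply: le_trans; rewrite le_eqVlt; apply/orP; left; apply/eqP.
  under [RHS]eq_bigr do rewrite E mulrDr mulrBr.
  rewrite big_split/= sumrB -mulr_suml wN.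
  have -> : \sum_i w i * (2 * dot (p i - c0) (X *m (c - c0))) = 0.
    rewrite -[RHS](mulr0 2) -[in RHS](dot0l (X *m (c - c0))) -m1 dot_suml mulr_sumr.
    by apply: eq_bigr => i _; rewrite dotZl; ring.
  rewrite subr0; congr (_ + _).
  rewrite mxtrace_mulC mulmxA -YE mxtrace_mulC mulmx_sumr raddf_sum.
  by apply: eq_bigr => i _; rewrite /= dot_tr -scalemxAr mxtraceZ.
(* [M0^T X M0] is [X] in coordinates where the reference ellipsoid is a unit ball; its determinant
   is the squared ratio of the reference volume to that of the competitor. *)
have detZ X M : frame X M ->
    \det (M0^T *m X *m M0) * (\prod_i M i i) ^+ 2 = (\prod_i M0 i i) ^+ 2.
  move=> fM; have trigM0 : is_trig_mx M0 by case: fM0.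
  rewrite !det_mulmx det_tr (det_trig trigM0).
  by rewrite -[RHS]mulr1 -[X in _ = _ * X](frame_det fM); ring.
have prod_gt0 X (M : 'M[R]_n.+1) : frame X M -> 0 < \prod_i M i i.
  by case=> _ Mpos _; exact: prodr_gt0.
have sq (X X' M M' : 'M[R]_n.+1) : frame X M -> frame X' M' ->
    (\prod_i M i i <= \prod_i M' i i) =
    ((\prod_i M i i) ^+ 2 <= (\prod_i M' i i) ^+ 2).
  move=> fM fM'; have M_gt0 := prod_gt0 _ _ fM; have M'_gt0 := prod_gt0 _ _ fM'.
  by rewrite ler_pXn2r// nnegrE ltW.
have posZ X : posdefmx X -> posdefmx (M0^T *m X *m M0).
  by move=> pX; apply: posdefmx_conj => //; exact: frame_unit fM0.
have trZ X c : posdefmx X -> K `<=` ellipsoid X c ->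
    \tr (M0^T *m X *m M0) <= n.+1%:R.
  move=> pX KE; apply: le_trans (key _ _ pX KE); rewrite lerDl mulr_ge0//.
  have [->|c0c] := eqVneq (c - c0) 0; first by rewrite mulmx0 dot0l.
  by apply/ltW; exact: pX.2.
have minE0 : min_volume_containing K (ellipsoid X0 c0).
  split=> //; first by exists X0, c0.
  move=> _ [X [c [pX ->]]] KE; have [M fM] := frame_exists pX.
  rewrite (le_volume_ellipsoid _ _ fM0 fM).
  rewrite (sq _ _ _ _ fM0 fM).
  rewrite -(detZ _ _ fM); apply: ler_piMl; first exact: sqr_ge0.
  by have [] := posdefmx_det_le1 (posZ _ pX) (trZ _ _ pX KE).
split=> // _ [[X [c [pX ->]]] KE minT].
have [M fM] := frame_exists pX.
have : (volume (ellipsoid X c) <= volume (ellipsoid X0 c0))%E.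
  by apply: minT => //; exists X0, c0.
rewrite (le_volume_ellipsoid _ _ fM fM0).
rewrite (sq _ _ _ _ fM fM0).
rewrite -(detZ _ _ fM) -[leLHS]mul1r ler_pM2r ?exprn_gt0 ?(prod_gt0 _ _ fM)//.
have [le1 eq1] := posdefmx_det_le1 (posZ _ pX) (trZ _ _ pX KE).
move=> ge1; have Z1 := eq1 (le_anti (introT andP (conj le1 ge1))).
have XX0 : X = X0.
  by apply: (frame_inj (M := M0)) => //; case: fM0 => trigM0 M0pos _; split.
(* The identity already has trace [n.+1], which exhausts the bound in [key] and leaves no room for
   distinct centers. *)
congr ellipsoid => //; apply/esym/eqP; rewrite -subr_eq0; apply: contraT => c0c.
have := key _ _ pX KE; rewrite Z1 mxtrace1 gerDl pmulr_rle0// leNgt.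
by rewrite pX.2.
Qed.

(** The linear form is maximal over the ellipsoid at [c + M y], with [y] the normalized [M^T v]. If
    that vector is 0, the convention [0^-1 = 0] gives [y = 0] and the center serves as the point. *)
Lemma ellipsoid_support (R : realType) (n : nat) (X M : 'M[R]_n)
    (c v : 'cV[R]_n) (h : R) : frame X M ->
  (forall x, ellipsoid X c x -> dot x v <= h) ->
  dot c v + enorm (M^T *m v) <= h.
Proof.
move=> fM; rewrite (frame_ellipsoid fM) => H.
set g := M^T *m v.
pose y := (enorm g)^-1 *: g.
have gg : (enorm g)^-1 * enorm g ^+ 2 = enorm g.
  by have [->|g0] := eqVneq (enorm g) 0; [rewrite expr0n mulr0|rewrite expr2 mulKf].
have yB : unit_ball y.
  rewrite /unit_ball/= dotZl dotZr -enormK gg.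
  by have [->|g0] := eqVneq (enorm g) 0; [rewrite mulr0|rewrite mulVf].
apply: le_trans (H _ (imageP _ yB)).
by rewrite dotDl dot_mull -/g dotZl -enormK gg.
Qed.

Lemma dot_eq_enorm (R : realType) (n : nat) (u v : 'cV[R]_n) :
  dot v v = 1 -> dot u v = enorm u -> u = enorm u *: v.
Proof.
move=> v1 uv; apply/eqP; rewrite -subr_eq0; apply/eqP/dot_eq0.
by rewrite dotBl !dotBr !dotZl !dotZr v1 (dotC v u) uv -enormK; ring.
Qed.

(** The half-spaces given by the [v i] contain [K], and the unit vectors [u i = D v i] decompose the
    identity. For an inscribed competitor with frame [M] put [T = D^-1 M]. Then [tr T] is the
    weighted sum of the [dot (T^T u i) (u i)], hence at most that of the norms of [M^T v i], which
    the support inequalities bound by the dimension. The diagonal of the triangular [T] therefore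
    has product at most 1. *)
Lemma IE_certificate (R : realType) (n : nat) (K : set 'cV[R]_n.+1)
    (I : finType) (w : I -> R) (v : I -> 'cV[R]_n.+1)
    (X0 : 'M[R]_n.+1) (d : 'rV[R]_n.+1) (c0 : 'cV[R]_n.+1) :
  posdefmx X0 -> frame X0 (diag_mx d) -> ellipsoid X0 c0 `<=` K ->
  (forall i, 0 <= w i) ->
  (forall i x, K x -> dot x (v i) <= dot c0 (v i) + 1) ->
  (forall i, dot (diag_mx d *m v i) (diag_mx d *m v i) = 1) ->
  \sum_i w i = n.+1%:R ->
  \sum_i w i *: v i = 0 ->
  \sum_i w i *: ((diag_mx d *m v i) *m (diag_mx d *m v i)^T) = 1%:M ->
  is_IE K (ellipsoid X0 c0).
Proof.
move=> pX0 fD E0K w0 Kv u1 wN m1 m2.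
set D := diag_mx d in fD u1 m2.
have uD := frame_unit fD.
have Dj j : D j j = d 0 j by rewrite mxE eqxx.
have d_gt0 j : 0 < d 0 j by case: fD => _ /(_ j); rewrite Dj.
(* Multiplying the decomposition of the identity by [A] lets traces be computed contact point by
   contact point. *)
have avg (A : 'M[R]_n.+1) : A = \sum_i w i *: (A *m (D *m v i) *m (D *m v i)^T).
  rewrite -[LHS]mulmx1 -m2 mulmx_sumr.
  by apply: eq_bigr => i _; rewrite -scalemxAr (mulmxA A (D *m v i)).
have sum_dot y : \sum_i w i * dot y (v i) = 0.
  rewrite -[RHS](dot0l y) -m1 dot_suml.
  by apply: eq_bigr => i _; rewrite dotZl dotC.
have Tu (M : 'M[R]_n.+1) i : (invmx D *m M)^T *m (D *m v i) = M^T *m v i.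
  rewrite trmx_mul trmx_inv tr_diag_mx -/D -!mulmxA; congr (_ *m _).
  by rewrite mulKmx.
have support X M c : frame X M -> ellipsoid X c `<=` K -> forall i,
    dot (c - c0) (v i) + enorm (M^T *m v i) <= 1.
  move=> fM EK i.
  have := ellipsoid_support fM (fun x Ex => Kv i x (EK x Ex)).
  by rewrite dotBl; lra.
have sum_enorm X M c : frame X M -> ellipsoid X c `<=` K ->
    \sum_i w i * enorm (M^T *m v i) <= n.+1%:R.
  move=> fM EK; rewrite -wN.
  have <- : \sum_i (w i * dot (c - c0) (v i) + w i * enorm (M^T *m v i)) =
      \sum_i w i * enorm (M^T *m v i) by rewrite big_split/= sum_dot add0r.
  apply: ler_sum => i _; rewrite -mulrDr -[leRHS]mulr1 ler_wpM2l//.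
  exact: support fM EK i.
have entry (M : 'M[R]_n.+1) i j : (invmx D *m M) i j = (d 0 i)^-1 * M i j.
  have -> : invmx D = diag_mx (\row_k (d 0 k)^-1).
    rewrite -[RHS]mul1mx -(mulVmx uD) -mulmxA mulmx_diag.
    rewrite (_ : diag_mx _ = 1%:M) ?mulmx1//.
    rewrite -diag_const_mx; congr diag_mx; apply/rowP => k.
    by rewrite !mxE mulfV ?gt_eqF.
  by rewrite mul_diag_mx !mxE.
have sum_diag X M c : frame X M -> ellipsoid X c `<=` K ->
    \sum_j (d 0 j)^-1 * M j j <= n.+1%:R.
  move=> fM EK; apply: le_trans (sum_enorm _ _ _ fM EK).
  have -> : \sum_j (d 0 j)^-1 * M j j = \tr (invmx D *m M)^T.
    by rewrite mxtrace_tr; apply: eq_bigr => j _; rewrite entry.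
  rewrite {1}(avg (invmx D *m M)^T) raddf_sum; apply: ler_sum => i _ /=.
  rewrite mxtraceZ ler_wpM2l// -mulmxA -dot_tr Tu; exact: dot_le_enorm.
have pos X M : frame X M -> forall j, 0 < (d 0 j)^-1 * M j j.
  by move=> [_ Mpos _] j; rewrite mulr_gt0// invr_gt0.
have prodE (M : 'M[R]_n.+1) : \prod_j ((d 0 j)^-1 * M j j) =
    (\prod_j D j j)^-1 * \prod_j M j j.
  by rewrite big_split prodfV; under [in RHS]eq_bigr do rewrite Dj.
have D_gt0 : 0 < \prod_j D j j by apply: prodr_gt0 => j _; rewrite Dj.
have maxE0 : max_volume_contained K (ellipsoid X0 c0).
  split=> //; first by exists X0, c0.
  move=> _ [X [c [pX ->]]] EK; have [M fM] := frame_exists pX.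
  rewrite (le_volume_ellipsoid _ _ fM fD).
  have [+ _] := prod_le1_of_sum (pos _ _ fM) (sum_diag _ _ _ fM EK).
  by rewrite prodE ler_pdivrMl// mulr1.
split=> // _ [[X [c [pX ->]]] EK maxT].
have [M fM] := frame_exists pX.
have : (volume (ellipsoid X0 c0) <= volume (ellipsoid X c))%E.
  by apply: maxT => //; exists X0, c0.
rewrite (le_volume_ellipsoid _ _ fD fM) => leDM.
have [le1 eq1] := prod_le1_of_sum (pos _ _ fM) (sum_diag _ _ _ fM EK).
have diag1 : forall j, (d 0 j)^-1 * M j j = 1.
  by apply/eq1/le_anti; rewrite le1 prodE ler_pdivlMl// mulr1.
(* All the inequalities above are equalities, so each [u i = D v i] is an
   eigenvector of [T^T]; hence [T] is symmetric as well as triangular. *)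
pose T := invmx D *m M.
have ME : M = D *m T by rewrite mulKVmx.
have T1 j : T j j = 1 by rewrite entry.
have eigen i : w i *: (T^T *m (D *m v i)) =
    w i *: (enorm (M^T *m v i) *: (D *m v i)).
  have [->|wi0] := eqVneq (w i) 0; first by rewrite !scale0r.
  congr (_ *: _); rewrite Tu; apply: dot_eq_enorm => //.
  have slack0 k : 0 <= w k * (enorm (M^T *m v k) - dot (M^T *m v k) (D *m v k)).
    by rewrite mulr_ge0// subr_ge0 dot_le_enorm.
  (* The total slack is at most [n.+1 - tr T], which is 0. *)
  have : \sum_k w k * (enorm (M^T *m v k) - dot (M^T *m v k) (D *m v k)) == 0.
    rewrite eq_le sumr_ge0 ?andbT//; under eq_bigr do rewrite mulrBr.
    rewrite sumrB subr_le0 (le_trans (sum_enorm _ _ _ fM EK))//.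
    have <- : \tr T^T = n.+1%:R.
      rewrite mxtrace_tr /mxtrace; under eq_bigr do rewrite T1.
      by rewrite sumr_const card_ord.
    rewrite {1}(avg T^T) raddf_sum; apply: ler_sum => k _ /=.
    by rewrite mxtraceZ -mulmxA -dot_tr Tu.
  rewrite psumr_eq0// => /allP/(_ i (mem_index_enum i)) /=.
  by rewrite mulf_eq0 (negbTE wi0)/= subr_eq0 => /eqP.
have TE : T^T = \sum_i w i *: (enorm (M^T *m v i) *:
    ((D *m v i) *m (D *m v i)^T)).
  rewrite [LHS](avg T^T); apply: eq_bigr => i _.
  by rewrite scalemxAl eigen -!scalemxAl.
have symT : T^T = T.
  rewrite -[RHS]trmxK TE linear_sum/=; apply: eq_bigr => i _.
  by rewrite !linearZ/= (trmx_mul (D *m v i)) trmxK.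
have trigT (i j : 'I_n.+1) : (i < j)%N -> T i j = 0.
  move=> ij; rewrite entry; case: fM => /is_trig_mxP trigM _ _.
  by rewrite trigM ?mulr0.
have MD : M = D.
  rewrite ME (_ : T = 1%:M) ?mulmx1//; apply/matrixP => i j; rewrite [RHS]mxE.
  case: (ltngtP i j) => [ij|ji|/val_inj->]; last by rewrite eqxx T1.
    by rewrite trigT// (_ : i == j = false)//; apply: ltn_eqF.
  rewrite -symT mxE trigT// (_ : i == j = false)//; exact: gtn_eqF.
rewrite MD in fM; congr ellipsoid; first exact: frame_inj fD fM.
(* With equal frames the support inequalities only bound the displacement of the center. Their
   weighted sum is 0, so each weighted term vanishes, and the decomposition of the identity then
   forces [c = c0]. *)
have le0 i : dot (c - c0) (v i) <= 0.
  have := support _ _ _ fM EK i.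
  by rewrite tr_diag_mx -/D /enorm u1 sqrtr1; lra.
have eq0 i : w i * dot (v i) (c - c0) = 0.
  have := sum_dot (c - c0) => /eqP; rewrite -oppr_eq0 -sumrN psumr_eq0.
    move=> /allP/(_ i (mem_index_enum i)) /=.
    by rewrite oppr_eq0 dotC => /eqP.
  by move=> k _; rewrite -mulrN mulr_ge0// oppr_ge0.
apply/esym/eqP; rewrite -subr_eq0 -[c - c0](mulKVmx uD).
rewrite -[invmx D *m _]mul1mx -m2 mulmx_suml big1 ?mulmx0// => i _.
rewrite -scalemxAl mul_outer scalerA dot_mull tr_diag_mx mulKVmx//.
by rewrite eq0 scale0r.
Qed.

(** * Forms [diag(a, b, ..., b)] and contact points spread over circles *)

Lemma diag_abM (R : realType) (n : nat) (a b a' b' : R) :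
  diag_ab a b *m diag_ab a' b' = diag_ab (a * a') (b * b') :> 'M[R]_n.+1.
Proof.
rewrite /diag_ab mulmx_diag; congr diag_mx; apply/rowP => i; rewrite !mxE.
by case: ifP.
Qed.

Lemma diag_ab1 (R : realType) (n : nat) : diag_ab 1 1 = 1%:M :> 'M[R]_n.+1.
Proof.
by apply/matrixP => i j; rewrite !mxE if_same.
Qed.

Lemma sum_diag_ab (R : realType) (n : nat) (E : finType) (w x y : E -> R) :
  \sum_e w e *: diag_ab (x e) (y e) =
  diag_ab (\sum_e w e * x e) (\sum_e w e * y e) :> 'M[R]_n.+1.
Proof.
apply/matrixP => i j; rewrite summxE !mxE.
under eq_bigr do rewrite !mxE.
case: (i =P j) => _; last by under eq_bigr do rewrite mulr0n mulr0; rewrite big1.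
under eq_bigr do rewrite mulr1n.
by rewrite mulr1n; case: ifP.
Qed.

Lemma dot_e1 (R : realType) (n : nat) (x : 'cV[R]_n.+1) : dot e1 x = x 0 0.
Proof.
rewrite /dot (bigD1 0)//= mxE mul1r big1 ?addr0// => i i0.
by rewrite mxE (negbTE i0) mul0r.
Qed.

Lemma dot_diag_ab (R : realType) (n : nat) (a b : R) (x : 'cV[R]_n.+1) :
  dot (diag_ab a b *m x) x = a * x 0 0 ^+ 2 + b * (dot x x - x 0 0 ^+ 2).
Proof.
rewrite mul_diag_mx /dot (bigD1 0)//= [in RHS](bigD1 0)//= !mxE eqxx.
rewrite -mulrA -expr2; congr (_ + _); rewrite addrAC subrr add0r mulr_sumr.
by apply: eq_bigr => i i0; rewrite !mxE (negbTE i0) mulrA.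
Qed.

Lemma sqr_coord_le_dot (R : realType) (n : nat) (x : 'cV[R]_n.+1) :
  x 0 0 ^+ 2 <= dot x x.
Proof.
by rewrite /dot (bigD1 0)//= expr2 lerDl sumr_ge0// => i _; rewrite -expr2 sqr_ge0.
Qed.

Lemma posdefmx_diag_ab (R : realType) (n : nat) (a b : R) : 0 < a -> 0 < b ->
  posdefmx (diag_ab a b : 'M[R]_n.+1).
Proof.
move=> a0 b0; split=> [|x x0]; first exact: tr_diag_mx.
rewrite dot_diag_ab; have := sqr_coord_le_dot x; rewrite le_eqVlt.
case/orP => [/eqP E|lt].
  rewrite -E subrr mulr0 addr0 pmulr_rgt0// E lt_neqAle dot_ge0 andbT.
  by apply: contra x0 => /eqP/esym/dot_eq0->.
apply: ltr_wpDl; first by rewrite mulr_ge0 ?sqr_ge0// ltW.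
by rewrite mulr_gt0// subr_gt0.
Qed.

Lemma frame_diag_ab (R : realType) (n : nat) (A B : R) : 0 < A -> 0 < B ->
  frame (diag_ab (A ^- 2) (B ^- 2)) (diag_ab A B : 'M[R]_n.+1).
Proof.
move=> A0 B0; split.
- exact: diag_mx_is_trig.
- by move=> i; rewrite !mxE eqxx mulr1n; case: ifP.
- rewrite tr_diag_mx !diag_abM -diag_ab1; congr diag_ab; field; exact: lt0r_neq0.
Qed.

(** Only [x_1] and the squared distance to the axis enter, so inclusions become inequalities in two
    real variables. *)
Lemma ellipsoid_diag_abE (R : realType) (n : nat) (a b tau : R)
    (x : 'cV[R]_n.+1) : ellipsoid (diag_ab a b) (tau *: e1) x <->
  a * (x 0 0 - tau) ^+ 2 + b * (dot x x - x 0 0 ^+ 2) <= 1.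
Proof.
rewrite /ellipsoid/= dot_diag_ab !(dotBl, dotBr, dotZl, dotZr).
rewrite (dotC x) !dot_e1 !mxE eqxx mulr1.
by rewrite (_ : dot x x - _ - _ - _ = dot x x - x 0 0 ^+ 2) //; ring.
Qed.

Lemma slabE (R : realType) (n : nat) (alpha beta : R) (x : 'cV[R]_n.+1) :
  slab n alpha beta x <-> dot x x <= 1 /\ alpha <= x 0 0 <= beta.
Proof. by rewrite /slab/= enorm_le1. Qed.

(* In dimension 1 there is no direction orthogonal to [e1] and [g] is zero. *)
Lemma directions (R : realType) (n : nat) :
  exists (I : finType) (l : I -> R) (g : I -> 'cV[R]_n.+1),
  [/\ (forall i, 0 <= l i) /\ \sum_i l i = 1,
      forall i, g i 0 0 = 0, forall i, dot (g i) (g i) = (0 < n)%:R,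
      \sum_i l i *: g i = 0 &
      \sum_i l i *: (g i *m (g i)^T) = diag_ab 0 n%:R^-1].
Proof.
have [->|n0] := posnP n.
  exists unit, (fun=> 1), (fun=> 0); split.
  - by split=> //; rewrite big_const card_unit /= addr0.
  - by move=> _; rewrite mxE.
  - by move=> _; rewrite dot0l.
  - by rewrite big1// => _ _; rewrite scaler0.
  - rewrite big1 => [|_ _]; last by rewrite mul0mx scaler0.
    by apply/matrixP => i j; rewrite !ord1 !mxE.
have nR0 : n%:R != 0 :> R by rewrite pnatr_eq0 -lt0n.
pose h (j : 'I_n) : 'cV[R]_n.+1 := delta_mx (lift 0 j) 0.
(* The vectors are plus and minus each basis vector orthogonal to [e1], equally weighted: the signs
   cancel the mean and each direction collects [2 / (2 n)]. *)
exists (bool * 'I_n)%type, (fun=> (2 * n%:R)^-1),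
  (fun p : bool * 'I_n => (-1) ^+ p.1 *: h p.2); split.
- split=> [i|]; first by rewrite invr_ge0 mulr_ge0.
  rewrite sumr_const card_prod card_bool card_ord -[_ *+ (2 * n)]mulr_natl.
  by rewrite natrM mulfV// mulf_neq0// pnatr_eq0.
- by move=> i; rewrite !mxE /= mulr0.
- move=> i; rewrite dotZl dotZr mulrA -expr2 sqrr_sign mul1r.
  rewrite /dot (bigD1 (lift 0 i.2))//= !mxE !eqxx mulr1 big1 ?addr0// => j ji.
  by rewrite !mxE (negbTE ji) mul0r.
- rewrite -(pair_bigA _ (fun (s : bool) j => (2 * n%:R)^-1 *: ((-1) ^+ s *: h j))) /=.
  rewrite big_bool -big_split big1//= => j _.
  by rewrite expr1 expr0 scaleN1r scale1r scalerN addNr.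
- rewrite -(pair_bigA _ (fun (s : bool) j => (2 * n%:R)^-1 *:
     (((-1) ^+ s *: h j) *m ((-1) ^+ s *: h j)^T))) /=.
  have E (s : bool) j : ((-1) ^+ s *: h j) *m ((-1) ^+ s *: h j)^T =
      delta_mx (lift 0 j) (lift 0 j).
    rewrite linearZ/= -scalemxAl -scalemxAr scalerA -expr2 sqrr_sign scale1r.
    by rewrite trmx_delta mul_delta_mx.
  under eq_bigr do under eq_bigr do rewrite E.
  rewrite big_bool/= -big_split/=; under eq_bigr do rewrite -scalerDl.
  rewrite -scaler_sumr; apply/matrixP => i j; rewrite !mxE summxE.
  have -> : (2 * n%:R)^-1 + (2 * n%:R)^-1 = n%:R^-1 :> R by field.
  case: (unliftP 0 i) => [k|] ->.
    rewrite (bigD1 k)//= mxE eqxx big1 => [|m mk]; last first.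
      by rewrite mxE (inj_eq lift_inj) eq_sym (negbTE mk).
    by rewrite addr0 andTb (eq_sym j); case: eqP; rewrite ?mulr1 ?mulr0.
  rewrite big1 ?mulr0 => [|m _]; last by rewrite mxE.
  by rewrite mul0rn.
Qed.

Lemma circle_mean (R : realType) (n : nat) (I : finType) (l : I -> R)
    (g : I -> 'cV[R]_n.+1) (t r : R) :
  \sum_i l i = 1 -> \sum_i l i *: g i = 0 ->
  \sum_i l i *: (t *: e1 + r *: g i) = t *: e1.
Proof.
move=> l1 lg; have E i : l i *: (t *: e1 + r *: g i) =
    l i *: (t *: e1) + r *: (l i *: g i).
  by rewrite scalerDr !scalerA (mulrC r).
under eq_bigr do rewrite E.
by rewrite big_split/= -scaler_suml l1 scale1r -scaler_sumr lg scaler0 addr0.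
Qed.

(** The mixed terms between [e1] and [g i] cancel because the [g i] have mean 0. *)
Lemma circle_moment (R : realType) (n : nat) (I : finType) (l : I -> R)
    (g : I -> 'cV[R]_n.+1) (t r : R) :
  \sum_i l i = 1 -> \sum_i l i *: g i = 0 ->
  \sum_i l i *: (g i *m (g i)^T) = diag_ab 0 n%:R^-1 ->
  \sum_i l i *: ((t *: e1 + r *: g i) *m (t *: e1 + r *: g i)^T) =
  diag_ab (t ^+ 2) (r ^+ 2 / n%:R).
Proof.
move=> l1 lg lgg.
have E i : l i *: ((t *: e1 + r *: g i) *m (t *: e1 + r *: g i)^T) =
    l i *: (t ^+ 2 *: (e1 *m e1^T)) + (t * r) *: (e1 *m (l i *: g i)^T)
    + (t * r) *: ((l i *: g i) *m e1^T) + r ^+ 2 *: (l i *: (g i *m (g i)^T)).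
  rewrite linearD/= !linearZ/= mulmxDl !mulmxDr -!(scalemxAl, scalemxAr).
  rewrite !scalerDr !scalerA !addrA; congr (_ *: _ + _ *: _ + _ *: _ + _ *: _); ring.
under eq_bigr do rewrite E; rewrite !big_split/= -scaler_suml l1 scale1r.
rewrite -!scaler_sumr -mulmx_sumr -mulmx_suml -linear_sum/= lg lgg.
rewrite trmx0 mulmx0 mul0mx !scaler0 !addr0.
apply/matrixP => i j; rewrite !mxE big_ord1 !mxE eqxx andbT.
case: (i =P j) => [->|/eqP ij].
  by rewrite !mulr1n; case: eqP => _; rewrite ?mulr0 ?mulr1 ?addr0 ?mul0r ?add0r.
rewrite !mulr0n mulr0 addr0.
case: (i =P 0) ij => [->|_ _]; last by rewrite mul0r mulr0.
by rewrite eq_sym => /negbTE->; rewrite mulr0 mulr0.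
Qed.

Lemma sum_pair (R : realType) (V : lmodType R) (E I : finType) (W : E -> R)
    (l : I -> R) (F : E -> I -> V) :
  \sum_(ei : E * I) (W ei.1 * l ei.2) *: F ei.1 ei.2 =
  \sum_e W e *: \sum_i l i *: F e i.
Proof.
rewrite -(pair_bigA _ (fun e i => (W e * l i) *: F e i))/=.
apply: eq_bigr => e _; rewrite scaler_sumr; apply: eq_bigr => i _.
by rewrite scalerA.
Qed.

(* Contact points spread over the circles [x_1 = t e, |x'| = r e] of the unit
   ball, which degenerate to single points when [n = 0]. *)
Lemma CE_circles (R : realType) (n : nat) (alpha beta a b tau : R)
    (E : finType) (W t r : E -> R) :
  0 < a -> 0 < b ->
  (forall x y, 0 <= y -> (n = 0%N -> y = 0) -> x ^+ 2 + y <= 1 ->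
     alpha <= x <= beta -> a * (x - tau) ^+ 2 + b * y <= 1) ->
  (forall e, 0 <= W e) -> (forall e, alpha <= t e <= beta) ->
  (forall e, t e ^+ 2 + r e ^+ 2 <= 1) ->
  \sum_e W e = n.+1%:R -> \sum_e W e * (t e - tau) = 0 ->
  a * (\sum_e W e * (t e - tau) ^+ 2) = 1 ->
  ((0 < n)%N -> b * (\sum_e W e * r e ^+ 2) = n%:R) ->
  is_CE (slab n alpha beta) (ellipsoid (diag_ab a b) (tau *: e1)).
Proof.
move=> a0 b0 KE W0 tab tr1 WN m1 m2 m2'.
have [I [l [g [[l0 l1] g0 gg lg lgg]]]] := directions R n.
pose w (ei : E * I) := W ei.1 * l ei.2.
pose p (ei : E * I) := t ei.1 *: e1 + r ei.1 *: g ei.2.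
have pc ei : p ei - tau *: e1 = (t ei.1 - tau) *: e1 + r ei.1 *: g ei.2.
  by rewrite scalerBl addrAC.
apply: (CE_certificate (w := w) (p := p)).
- exact: posdefmx_diag_ab.
- move=> x /slabE[x1 xab]; apply/ellipsoid_diag_abE; apply: KE => //.
  + by rewrite subr_ge0 sqr_coord_le_dot.
  + by move=> n0; rewrite /dot; subst n; rewrite big_ord1 expr2 subrr.
  + by rewrite subrKC.
- by move=> ei; rewrite mulr_ge0.
- move=> ei; apply/slabE; split.
    rewrite /p dotDl !dotDr !dotZl !dotZr !dot_e1 (dotC _ e1) dot_e1 g0 mxE eqxx gg.
    rewrite !mulr0 addr0 add0r mulr1 mulrA -!expr2.
    apply: le_trans (tr1 ei.1); rewrite lerD2l ler_piMr ?sqr_ge0//.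
    by case: (0 < n)%N.
  by rewrite !mxE eqxx g0 mulr0 addr0 mulr1.
- rewrite -WN -(pair_bigA _ (fun e i => W e * l i))/=.
  by apply: eq_bigr => e _; rewrite -mulr_sumr l1 mulr1.
- under eq_bigr do rewrite pc.
  rewrite (sum_pair W l (fun e i => (t e - tau) *: e1 + r e *: g i)).
  under eq_bigr do rewrite circle_mean// scalerA.
  by rewrite -scaler_suml m1 scale0r.
- under eq_bigr do rewrite pc.
  rewrite (sum_pair W l (fun e i => ((t e - tau) *: e1 + r e *: g i) *m
    ((t e - tau) *: e1 + r e *: g i)^T)).
  under eq_bigr do rewrite circle_moment//.
  rewrite sum_diag_ab diag_abM m2 -diag_ab1.
  under [X in b * X]eq_bigr do rewrite mulrA.
  rewrite -mulr_suml mulrA.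
  have [n0|n0] := posnP n.
    by subst n; apply/matrixP => i j; rewrite !ord1 !mxE.
  by rewrite m2'// mulfV// pnatr_eq0 -lt0n.
Qed.

(** Counterpart of [CE_circles] with half-spaces. In the coordinates where the ellipsoid is the unit
    ball, its contact points have height [s e] and radius [rho e]; [q] stands for the component of a
    slab point along one direction [g i]. *)
Lemma IE_circles (R : realType) (n : nat) (alpha beta A B tau : R)
    (E : finType) (W s rho : E -> R) :
  0 < A -> 0 < B ->
  (forall x y, 0 <= y -> (n = 0%N -> y = 0) ->
     A ^- 2 * (x - tau) ^+ 2 + B ^- 2 * y <= 1 ->
     x ^+ 2 + y <= 1 /\ alpha <= x <= beta) ->
  (forall e, 0 <= W e) ->
  (forall e x q, x ^+ 2 + q ^+ 2 <= 1 -> alpha <= x <= beta ->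
     (x - tau) * (s e / A) + q * (rho e / B) <= 1) ->
  (forall e, s e ^+ 2 + rho e ^+ 2 = 1) ->
  (forall e, n = 0%N -> rho e = 0) ->
  \sum_e W e = n.+1%:R -> \sum_e W e * s e = 0 ->
  \sum_e W e * s e ^+ 2 = 1 ->
  ((0 < n)%N -> \sum_e W e * rho e ^+ 2 = n%:R) ->
  is_IE (slab n alpha beta) (ellipsoid (diag_ab (A ^- 2) (B ^- 2)) (tau *: e1)).
Proof.
move=> A0 B0 EK W0 half srho1 rho0 WN m1 m2 m2'.
have [I [l [g [[l0 l1] g0 gg lg lgg]]]] := directions R n.
pose w (ei : E * I) := W ei.1 * l ei.2.
pose v (ei : E * I) := (s ei.1 / A) *: e1 + (rho ei.1 / B) *: g ei.2.
have Dv ei : diag_ab A B *m v ei = s ei.1 *: e1 + rho ei.1 *: g ei.2.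
  apply/colP => i; rewrite mul_diag_mx !mxE; case: (i =P 0) => [->|_].
    by rewrite g0 eqxx /= !mulr0 !addr0 !mulr1 mulrC divfK// gt_eqF.
  by rewrite /= !mulr0 !add0r mulrA [B * _]mulrC divfK// gt_eqF.
(* Bessel's inequality: [g i] is orthogonal to [e1] and has length 1 or 0. *)
have dot_g x i : dot x (g i) ^+ 2 <= dot x x - x 0 0 ^+ 2.
  pose y := x - x 0 0 *: e1.
  have yg : dot y (g i) = dot x (g i) by rewrite dotBl dotZl dot_e1 g0 mulr0 subr0.
  have yy : dot y y = dot x x - x 0 0 ^+ 2.
    rewrite dotBl !dotBr !dotZl !dotZr (dotC x e1) !dot_e1 mxE eqxx /=; ring.
  move: y yg yy => y yg yy; have := dot_ge0 (y - dot x (g i) *: g i).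
  rewrite -yy dotBl !dotBr !dotZl !dotZr (dotC (g i) y) yg gg.
  have := sqr_ge0 (dot x (g i)).
  by case: (0 < n)%N => /=; lra.
have vc ei : dot (tau *: e1) (v ei) = tau * (s ei.1 / A).
  by rewrite dotZl dot_e1 !mxE g0 eqxx mulr0 addr0 mulr1.
apply: (IE_certificate (w := w) (v := v) (posdefmx_diag_ab _ _ _)
  (frame_diag_ab n A0 B0)).
- by rewrite invr_gt0 exprn_gt0.
- by rewrite invr_gt0 exprn_gt0.
- move=> x /ellipsoid_diag_abE; case/EK.
  + by rewrite subr_ge0 sqr_coord_le_dot.
  + by move=> n0; rewrite /dot; subst n; rewrite big_ord1 expr2 subrr.
  + by rewrite subrKC => x1 xab; apply/slabE.
- by move=> ei; rewrite mulr_ge0.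
- move=> ei x /slabE[x1 xab]; rewrite vc dotDr !dotZr (dotC x e1) dot_e1.
  have := half ei.1 (x 0 0) (dot x (g ei.2)).
  have := dot_g x ei.2; move=> H /(_ _ xab) H'.
  have {}H' := H' (le_trans _ x1); move: H'; rewrite -lerBrDl => /(_ H); lra.
- move=> ei; rewrite Dv dotDl !dotDr !dotZl !dotZr !dot_e1 (dotC _ e1) dot_e1.
  rewrite g0 mxE eqxx gg -[RHS](srho1 ei.1).
  have [n0|n0] := posnP n; last by rewrite /=; ring.
  by rewrite !rho0//=; ring.
- rewrite -WN -(pair_bigA _ (fun e i => W e * l i))/=.
  by apply: eq_bigr => e _; rewrite -mulr_sumr l1 mulr1.
- rewrite (sum_pair W l (fun e i => (s e / A) *: e1 + (rho e / B) *: g i)).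
  under eq_bigr do rewrite circle_mean// scalerA mulrA.
  by rewrite -scaler_suml -mulr_suml m1 mul0r scale0r.
- under eq_bigr do rewrite -/(diag_ab A B) Dv.
  rewrite (sum_pair W l (fun e i => (s e *: e1 + rho e *: g i) *m
    (s e *: e1 + rho e *: g i)^T)).
  under eq_bigr do rewrite circle_moment//.
  rewrite sum_diag_ab m2 -diag_ab1.
  under [X in diag_ab _ X]eq_bigr do rewrite mulrA.
  rewrite -mulr_suml.
  have [n0|n0] := posnP n.
    by subst n; apply/matrixP => i j; rewrite !ord1 !mxE.
  by rewrite m2'// mulfV// pnatr_eq0 -lt0n.
Qed.

(** * The ellipsoids of the slab *)

(** Centering at [tau] fixes the weights up to scale: [t2 - tau] on the circle at [t1] and
    [tau - t1] on the one at [t2]. The second moment along [e1] is then the product hypothesis, and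
    the transverse moment follows by averaging the two contact equations. *)
Lemma CE_two_circles (R : realType) (n : nat) (alpha beta a b tau t1 t2 : R) :
  0 < a -> 0 < b ->
  (forall x y, 0 <= y -> (n = 0%N -> y = 0) -> x ^+ 2 + y <= 1 ->
     alpha <= x <= beta -> a * (x - tau) ^+ 2 + b * y <= 1) ->
  -1 <= t1 -> alpha <= t1 -> t1 < t2 -> t2 <= beta -> t2 <= 1 ->
  n.+1%:R * (a * ((tau - t1) * (t2 - tau))) = 1 ->
  ((0 < n)%N -> a * (t1 - tau) ^+ 2 + b * (1 - t1 ^+ 2) = 1 /\
                a * (t2 - tau) ^+ 2 + b * (1 - t2 ^+ 2) = 1) ->
  is_CE (slab n alpha beta) (ellipsoid (diag_ab a b) (tau *: e1)).
Proof.
move=> a0 b0 KE t1N at1 t12 t2b t21 prod1 contact.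
have N0 : 0 < n.+1%:R :> R by [].
have P0 : 0 < (tau - t1) * (t2 - tau).
  by rewrite -(pmulr_rgt0 _ a0) -(pmulr_rgt0 _ N0) prod1.
have tau1 : t1 < tau.
  by rewrite ltNge; apply/negP => H; nra.
have tau2 : tau < t2.
  by rewrite ltNge; apply/negP => H; nra.
have t21n0 : t2 - t1 != 0 by rewrite subr_eq0 gt_eqF.
pose t (e : bool) := if e then t1 else t2.
pose r (e : bool) := if n == 0%N then 0 else Num.sqrt (1 - t e ^+ 2).
pose W (e : bool) := n.+1%:R * ((if e then t2 - tau else tau - t1) / (t2 - t1)).
have t_sqr e : t e ^+ 2 <= 1 by rewrite /t; case: e; nra.
apply: (CE_circles (W := W) (t := t) (r := r)) => //.
- move=> e; rewrite /W mulr_ge0// divr_ge0 ?subr_ge0 ?(ltW t12)//.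
  by case: e; rewrite subr_ge0 ltW.
- by move=> e; rewrite /t; case: e; lra.
- move=> e; rewrite /r; case: eqP => _; first by rewrite expr0n addr0.
  by rewrite sqr_sqrtr ?subr_ge0// subrKC.
- by rewrite big_bool /W /=; field.
- by rewrite big_bool /W /t /=; field.
- by rewrite big_bool /W /t -[RHS]prod1 /=; field.
- move=> n0; have [C1 C2] := contact n0.
  have r_sqr e : r e ^+ 2 = 1 - t e ^+ 2.
    by rewrite /r gtn_eqF// sqr_sqrtr// subr_ge0.
  rewrite big_bool !r_sqr mulrDr ![b * (W _ * _)]mulrCA.
  have -> : b * (1 - t true ^+ 2) = 1 - a * (t1 - tau) ^+ 2 by rewrite /t; lra.
  have -> : b * (1 - t false ^+ 2) = 1 - a * (t2 - tau) ^+ 2 by rewrite /t; lra.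
  transitivity (n.+1%:R - n.+1%:R * (a * ((tau - t1) * (t2 - tau))) : R).
    by rewrite /W /=; field.
  by rewrite prod1 -natr1 addrK.
Qed.

(* On the segment [x^2 + y = 1], the left-hand side below minus 1 is a quadratic
   in [x] with leading coefficient [a - b] and roots [alpha], [beta]. *)
Lemma slab_sub_ellipsoid (R : realType) (alpha beta a b tau x y : R) :
  0 <= b -> b <= a -> alpha < beta ->
  a * (alpha - tau) ^+ 2 + b * (1 - alpha ^+ 2) = 1 ->
  a * (beta - tau) ^+ 2 + b * (1 - beta ^+ 2) = 1 ->
  x ^+ 2 + y <= 1 -> alpha <= x <= beta -> a * (x - tau) ^+ 2 + b * y <= 1.
Proof.
move=> b0 ba ab Ca Cb xy /andP[ax xb].
have : b * y <= b * (1 - x ^+ 2) by rewrite ler_wpM2l//; lra.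
move=> Hy; apply: (@le_trans _ _ (a * (x - tau) ^+ 2 + b * (1 - x ^+ 2))); first lra.
rewrite -subr_le0 -(pmulr_rle0 _ (_ : 0 < beta - alpha)) ?subr_gt0//.
have -> : (beta - alpha) * (a * (x - tau) ^+ 2 + b * (1 - x ^+ 2) - 1) =
  (a * (alpha - tau) ^+ 2 + b * (1 - alpha ^+ 2) - 1) * (beta - x) +
  (a * (beta - tau) ^+ 2 + b * (1 - beta ^+ 2) - 1) * (x - alpha) -
  (beta - alpha) * ((a - b) * ((x - alpha) * (beta - x))) by ring.
rewrite Ca Cb subrr !mul0r addr0 add0r oppr_le0.
by rewrite !mulr_ge0// subr_ge0// ltW.
Qed.

(** Beyond dimension 1, either the unit ball itself is optimal, or the ellipsoid passes through both
    rims [x_1 = alpha] and [x_1 = beta] of the slab; in the latter case symmetric slabs have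
    explicit parameters and the others a [tau] found by the intermediate value theorem. *)
Lemma CE_slab (R : realType) (n : nat) (alpha beta : R)
    (h_alpha : -1 <= alpha) (h_lt : alpha < beta) (h_beta : beta <= 1)
    (h_sq : alpha ^+ 2 <= beta ^+ 2) :
  exists a b tau : R, [/\ 0 < a, 0 < b,
    is_CE (slab n alpha beta) (ellipsoid (diag_ab a b) (tau *: e1)) &
    alpha = - beta -> tau = 0].
Proof.
have sigma0 : 0 <= alpha + beta.
  by rewrite -(pmulr_rge0 _ (_ : 0 < beta - alpha)) ?subr_gt0//; nra.
have [n0|n0] := posnP n.
  pose d := (beta - alpha) / 2.
  have d0 : 0 < d by rewrite divr_gt0// subr_gt0.
  exists (d ^- 2), 1, ((alpha + beta) / 2); split=> //.
  - by rewrite invr_gt0 exprn_gt0.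
  - apply: (CE_two_circles (t1 := alpha) (t2 := beta)) => //.
    + by rewrite invr_gt0 exprn_gt0.
    + move=> x y _ /(_ n0)-> _ xab; rewrite mulr0 addr0 ler_pdivrMl ?exprn_gt0//.
      by rewrite /d; nra.
    + by rewrite n0 mul1r /d; field; rewrite subr_eq0 gt_eqF.
    + by rewrite n0.
  - by move=> ->; rewrite addNr mul0r.
set N : R := n.+1%:R.
have N0 : 0 < N by [].
have N1 : 1 < N by rewrite /N ltr1n.
have [big|small] := leP 1 (- (N * (alpha * beta))).
  have ab0 : alpha * beta < 0.
    rewrite ltNge; apply/negP => ab0.
    have := mulr_ge0 (ltW N0) ab0; lra.
  have beta0 : 0 < beta by rewrite ltNge; apply/negP => b0; nra.
  (* For the unit ball, one circle is the rim at [beta]; the moment condition then puts the other at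
     [- (N * beta)^-1], which lies in the slab exactly by [big]. *)
  exists 1, 1, 0; split=> //.
  have at1 : alpha <= - (N * beta)^-1.
    rewrite lerNr -[leLHS]mul1r ler_pdivrMr ?mulr_gt0//.
    apply: le_trans big _; rewrite le_eqVlt; apply/orP; left; apply/eqP; ring.
  have t1beta : - (N * beta)^-1 < beta.
    by apply: (@lt_trans _ _ 0) => //; rewrite oppr_lt0 invr_gt0 mulr_gt0.
  apply: (CE_two_circles (t1 := - (N * beta)^-1) (t2 := beta)) => //.
  - by move=> x y _ _ xy _; rewrite subr0 !mul1r.
  - exact: le_trans at1.
  - by rewrite -/N; field; rewrite !gt_eqF.
  - by move=> _; rewrite !subr0 !mul1r !subrKC.
have [s0|s0] := eqVneq (alpha + beta) 0.
  have ab : alpha = - beta by lra.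
  have beta0 : 0 < beta by lra.
  have Nb1 : N * beta ^+ 2 < 1 by move: small; rewrite ab; nra.
  have b1 : beta ^+ 2 < 1 by nra.
  (* With [tau = 0] the moment condition determines [a] and the contact equation determines [b];
     [small] becomes [N * beta ^+ 2 < 1] and gives [b < 1 < a]. *)
  pose a := (N * beta ^+ 2)^-1; pose b := (1 - N^-1) / (1 - beta ^+ 2).
  have aE : a * beta ^+ 2 = N^-1 by rewrite /a; field; rewrite !gt_eqF.
  have bE : b * (1 - beta ^+ 2) = 1 - N^-1 by rewrite divfK// subr_eq0 gt_eqF.
  have Nb2 : 0 < N * beta ^+ 2 by rewrite mulr_gt0// exprn_gt0.
  have a0 : 0 < a by rewrite invr_gt0.
  have a1 : 1 < a by rewrite invf_gt1.
  have b0 : 0 < b by rewrite divr_gt0 ?subr_gt0// invf_lt1.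
  have b_lt1 : b < 1.
    by rewrite ltr_pdivrMr ?subr_gt0// mul1r ltrD2l ltrN2 -aE ltr_pMl// exprn_gt0.
  have contact : a * (beta - 0) ^+ 2 + b * (1 - beta ^+ 2) = 1.
    by rewrite subr0 aE bE; ring.
  have contact' : a * (alpha - 0) ^+ 2 + b * (1 - alpha ^+ 2) = 1.
    by rewrite ab subr0 sqrrN aE bE; ring.
  exists a, b, 0; split=> //.
  apply: (CE_two_circles (t1 := alpha) (t2 := beta)) => //.
    move=> x y _ _; apply: slab_sub_ellipsoid => //; first exact: ltW.
    exact/ltW/(lt_trans b_lt1).
  by rewrite -/N ab /a; field; rewrite !gt_eqF.
have {s0 sigma0} sigma0 : 0 < alpha + beta by rewrite lt_neqAle eq_sym s0.
have beta0 : 0 < beta by lra.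
have alpha1 : alpha ^+ 2 < 1.
  have : 0 < (1 - alpha) * (1 + alpha) by apply: mulr_gt0; lra.
  lra.
set sg := alpha + beta in sigma0 *.
(* The moment condition gives [a] in terms of [tau], and the difference of the contact equations
   gives [b = a * (1 - 2 * tau / sg)]. What remains, the contact equation at [alpha], is
   [g tau = 0]. *)
pose g x := N * ((x - alpha) * (beta - x)) - (x - alpha) ^+ 2
  - (1 - 2 * x / sg) * (1 - alpha ^+ 2).
(* A root above [m] and below [sg / 2] yields [a > 0] and [0 < b <= a]. When [alpha < 0], negativity
   of [g] at [m = 0] is [small]. *)
pose m := Num.max 0 alpha.
have gm : g m < 0.
  rewrite /m /g; case: (leP 0 alpha) => al.
    have : 0 < (1 - 2 * alpha / sg) * (1 - alpha ^+ 2).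
      rewrite mulr_gt0// subr_gt0// ltr_pdivrMr// /sg; lra.
    set T := (1 - _) * _ => T0; rewrite (_ : _ - T = - T) ?oppr_lt0//; ring.
  by rewrite mulr0 mul0r; move: small; lra.
have gs : 0 < g (sg / 2).
  rewrite /g [2 * _]mulrC divfK// mulfV ?gt_eqF// subrr mul0r subr0.
  have -> : beta - sg / 2 = (beta - alpha) / 2 by rewrite /sg; field.
  have -> : sg / 2 - alpha = (beta - alpha) / 2 by rewrite /sg; field.
  have : 0 < ((beta - alpha) / 2) ^+ 2 by rewrite exprn_gt0// divr_gt0// subr_gt0.
  rewrite -expr2; set D := _ ^+ 2 => D0.
  by rewrite -[X in _ - X]mul1r -mulrBl mulr_gt0// subr_gt0.
have ms : m <= sg / 2 by rewrite /m ge_max divr_ge0 ?ltW//= /sg; lra.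
pose p : {poly R} := N%:P * (('X - alpha%:P) * (beta%:P - 'X)) - ('X - alpha%:P) ^+ 2
  - (1 - (2 / sg)%:P * 'X) * (1 - alpha ^+ 2)%:P.
have pE x : p.[x] = g x.
  by rewrite /p /g !hornerE; field; rewrite gt_eqF.
have [|tau] := @poly_ivt _ p m (sg / 2) ms.
  by rewrite !pE (ltW gm) (ltW gs).
move=> /andP[mtau taus]; rewrite /root pE => /eqP gtau.
have {}mtau : m < tau.
  by rewrite lt_neqAle mtau andbT; apply/eqP => E; move: gm; rewrite E gtau ltxx.
have {}taus : tau < sg / 2.
  by rewrite lt_neqAle taus andbT; apply/eqP => E; move: gs; rewrite -E gtau ltxx.
have [tau0 atau] : 0 < tau /\ alpha < tau.
  by move: mtau; rewrite /m gt_max => /andP[].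
have taub : tau < beta by move: taus; rewrite /sg; lra.
have P0 : 0 < (tau - alpha) * (beta - tau) by rewrite mulr_gt0 ?subr_gt0.
pose a := (N * ((tau - alpha) * (beta - tau)))^-1.
pose b := a * (1 - 2 * tau / sg).
have a0 : 0 < a by rewrite invr_gt0 mulr_gt0.
have k0 : 0 < 2 * tau / sg < 1.
  by rewrite divr_gt0 ?mulr_gt0//= ltr_pdivrMr// mul1r; lra.
have b0 : 0 < b by rewrite mulr_gt0//; lra.
have ba : b <= a by rewrite ler_piMr ?(ltW a0)//; lra.
have contact : a * (alpha - tau) ^+ 2 + b * (1 - alpha ^+ 2) = 1.
  transitivity (a * (N * ((tau - alpha) * (beta - tau)) - g tau)).
    by rewrite /b /g; ring.
  by rewrite gtau subr0 mulVf// gt_eqF// mulr_gt0.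
have contact' : a * (beta - tau) ^+ 2 + b * (1 - beta ^+ 2) = 1.
  rewrite -[RHS]contact /b /sg; field.
  by rewrite -/sg gt_eqF.
exists a, b, tau; split=> //; last by move=> ab; move: sigma0; rewrite /sg ab addNr ltxx.
apply: (CE_two_circles (t1 := alpha) (t2 := beta)) => //.
  by move=> x y _ _; apply: slab_sub_ellipsoid => //; exact: ltW.
by rewrite -/N mulrCA mulVf// gt_eqF// mulr_gt0.
Qed.

(** * The inscribed ellipsoid of the slab *)

Lemma sqr_le_bounds (R : realDomainType) (x d : R) :
  0 <= d -> x ^+ 2 <= d ^+ 2 -> - d <= x <= d.
Proof.
by move=> d0 H; rewrite -ler_norml -(ler_pXn2r (n := 2))// real_normK ?num_real.
Qed.

Lemma IE_segment (R : realType) (n : nat) (alpha beta : R) : n = 0%N ->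
  -1 <= alpha -> alpha < beta -> beta <= 1 ->
  is_IE (slab n alpha beta) (ellipsoid
    (diag_ab (((beta - alpha) / 2) ^- 2) (1 ^- 2)) (((alpha + beta) / 2) *: e1)).
Proof.
move=> n0 a1 ab b1.
set d := (beta - alpha) / 2; have d0 : 0 < d by rewrite divr_gt0// subr_gt0.
pose s (e : bool) : R := if e then 1 else -1.
apply: (IE_circles (W := fun=> 1 / 2) (s := s) (rho := fun=> 0)) => //.
- move=> x y _ /(_ n0)->; rewrite mulr0 addr0 ler_pdivrMl ?exprn_gt0// mulr1.
  move=> /(sqr_le_bounds (ltW d0)) /andP[x1 x2].
  have xab : alpha <= x <= beta by move: x1 x2; rewrite /d; lra.
  split=> //; rewrite addr0; case/andP: xab => xa xb.
  have : 0 <= (1 - x) * (1 + x) by apply: mulr_ge0; lra.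
  lra.
- move=> e x q _ xab; rewrite mul0r mulr0 addr0 mulrA ler_pdivrMr// mul1r.
  by rewrite /s /d; case: e; lra.
- by move=> e; rewrite /s expr0n addr0; case: e; rewrite ?sqrrN expr1n.
- by rewrite big_bool n0 /=; field.
- by rewrite big_bool /s /=; ring.
- by rewrite big_bool /s /=; field.
- by rewrite n0.
Qed.

(* The ellipsoid touches the plane [x_1 = tau - A] at its pole and the unit
   sphere along the circle [x_1 = tau + A s]; [s2 = 1] when it also touches the
   plane [x_1 = beta], while [s2 = -1] and [q = 0] when it does not. *)
Lemma IE_tangent (R : realType) (n : nat)
    (alpha beta A B tau s s2 p q w : R) :
  0 < A -> 0 < B -> A <= B -> (0 < n)%N -> alpha = tau - A -> tau + A <= beta ->
  (s2 = -1 \/ s2 = 1 /\ beta = tau + A) ->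
  s ^+ 2 <= 1 ->
  A * (tau + A * s) = s * B ^+ 2 -> tau * (tau + A * s) + B ^+ 2 = 1 ->
  0 <= p -> 0 <= q -> 0 <= w ->
  p + q + w = n.+1%:R -> - p + q * s2 + w * s = 0 -> p + q + w * s ^+ 2 = 1 ->
  is_IE (slab n alpha beta) (ellipsoid (diag_ab (A ^- 2) (B ^- 2)) (tau *: e1)).
Proof.
move=> A0 B0 AB n0 tA tB s2E s1 T1 T2 p0 q0 w0 W0 W1 W2.
have A2 : 0 < A ^+ 2 by rewrite exprn_gt0.
have B2 : 0 < B ^+ 2 by rewrite exprn_gt0.
have s2_sqr : s2 ^+ 2 = 1 by case: s2E => [|[]] ->; rewrite ?sqrrN expr1n.
pose rho := Num.sqrt (1 - s ^+ 2).
have rhoE : rho ^+ 2 = 1 - s ^+ 2 by rewrite sqr_sqrtr// subr_ge0.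
pose S (e : 'I_3) := [:: -1; s2; s]`_e.
pose P (e : 'I_3) := [:: 0; 0; rho]`_e.
pose W (e : 'I_3) := [:: p; q; w]`_e.
apply: (IE_circles (W := W) (s := S) (rho := P)) => //.
- move=> x y y0 _ xyE; split.
    pose k := B ^+ 2 / A ^+ 2.
    have k1 : 1 <= k by rewrite ler_pdivlMr// mul1r lerXn2r// nnegrE ltW.
    have kA : k * A ^+ 2 = B ^+ 2 by rewrite divfK// gt_eqF.
    have y1 : y <= B ^+ 2 - k * (x - tau) ^+ 2.
      have : B ^+ 2 * (A ^- 2 * (x - tau) ^+ 2 + B ^- 2 * y) <= B ^+ 2 * 1.
        by rewrite ler_pM2l.
      rewrite mulrDr mulVKf ?gt_eqF// mulrA -/k; lra.
    (* By tangency the gap between sphere and ellipsoid has a double root at the contact height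
       [tau + A * s]. *)
    have E1 : 1 - x ^+ 2 - (B ^+ 2 - k * (x - tau) ^+ 2) =
        (k - 1) * (x - tau - A * s) ^+ 2.
      have K1 : (k - 1) * (A * s) = tau.
        apply: (mulIf (lt0r_neq0 A0)).
        transitivity (s * (k * A ^+ 2) - s * A ^+ 2); first by ring.
        by rewrite kA -T1; ring.
      transitivity ((k - 1) * (x - tau) ^+ 2 - 2 * (x - tau) * ((k - 1) * (A * s))
        + ((k - 1) * (A * s)) * (A * s)); last by ring.
      by rewrite K1 -[X in X - _ - _]T2; ring.
    have : 0 <= (k - 1) * (x - tau - A * s) ^+ 2.
      by rewrite mulr_ge0 ?sqr_ge0// subr_ge0.
    rewrite -E1; lra.
  have : A ^- 2 * (x - tau) ^+ 2 <= 1.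
    by apply: le_trans xyE; rewrite lerDl mulr_ge0// invr_ge0 ltW.
  rewrite ler_pdivrMl// mulr1 => xA.
  by have /andP[] := sqr_le_bounds (ltW A0) xA; lra.
- case=> [[|[|[|e]]] e3] //=; rewrite /W /=.
- case=> [[|[|[|e]]] e3] //= x z xz /andP[ax xb]; rewrite /S /P /=.
  + rewrite mul0r mulr0 addr0 mulrA ler_pdivrMr// mul1r; lra.
  + rewrite mul0r mulr0 addr0 mulrA ler_pdivrMr// mul1r.
    by case: s2E => [->|[-> ?]]; lra.
  + have B0' := lt0r_neq0 B0; have A0' := lt0r_neq0 A0.
    have -> : (x - tau) * (s / A) + z * (rho / B) =
        ((x - tau) * (tau + A * s) + z * (B * rho)) / B ^+ 2.
      have -> : tau + A * s = s * B ^+ 2 / A by rewrite -T1; field.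
      by field; rewrite A0' B0'.
    rewrite ler_pdivrMr// mul1r.
    (* The contact point lies on the unit sphere and, by the second tangency equation, the
       half-space is bounded by the tangent plane there; the claim reduces to the two squares
       below. *)
    have H1 : (tau + A * s) ^+ 2 + (B * rho) ^+ 2 = 1.
      rewrite exprMn rhoE -[RHS]T2.
      have -> : (tau + A * s) ^+ 2 = tau * (tau + A * s) + s * (A * (tau + A * s)).
        by ring.
      by rewrite T1; ring.
    have := sqr_ge0 (x - (tau + A * s)); have := sqr_ge0 (z - B * rho); lra.
- by case=> [[|[|[|e]]] e3] //=; rewrite /S /P /= ?expr0n ?addr0 ?sqrrN ?expr1n// rhoE subrKC.
- by move=> e E0; rewrite E0 in n0.
- by rewrite !big_ord_recl big_ord0 /W /= addr0 addrA.
- by rewrite !big_ord_recl big_ord0 /W /S /= -[RHS]W1; ring.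
- by rewrite !big_ord_recl big_ord0 /W /S /= -[RHS]W2 s2_sqr; ring.
- move=> _; rewrite !big_ord_recl big_ord0 /W /P /= rhoE.
  have -> : n%:R = n.+1%:R - 1 :> R by rewrite -natr1 addrK.
  by rewrite -W0 -[X in _ = _ - X]W2; ring.
Qed.

(** The moment conditions determine [w = n / (1 - s ^+ 2)], then [p + q = 1 - w * s ^+ 2] and
    [p - q = w * s]. Nonnegativity of [q] amounts to [s * n.+1 <= 1]. *)
Lemma IE_tangent2 (R : realType) (n : nat) (alpha beta A B tau s : R) :
  0 < A -> 0 < B -> A <= B -> (0 < n)%N ->
  alpha = tau - A -> beta = tau + A -> 0 <= s -> s * n.+1%:R <= 1 ->
  A * (tau + A * s) = s * B ^+ 2 -> tau * (tau + A * s) + B ^+ 2 = 1 ->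
  is_IE (slab n alpha beta) (ellipsoid (diag_ab (A ^- 2) (B ^- 2)) (tau *: e1)).
Proof.
move=> A0 B0 AB n0 tA tB s0 sN T1 T2.
have N1 : 1 < n.+1%:R :> R by rewrite ltr1n.
have NE : n.+1%:R = n%:R + 1 :> R by rewrite natr1.
have s1 : s < 1.
  by rewrite ltNge; apply/negP => s1; have := ler_pM ler01 (ltW ltr01) s1 (ltW N1); nra.
have s21 : 0 < 1 - s ^+ 2.
  rewrite (_ : 1 - s ^+ 2 = (1 - s) * (1 + s)); last by ring.
  by apply: mulr_gt0; lra.
pose w := n%:R / (1 - s ^+ 2).
have wE : w * (1 - s ^+ 2) = n%:R by rewrite divfK// gt_eqF.
have w0 : 0 <= w by rewrite divr_ge0// ltW.
have ws0 : 0 <= w * s by rewrite mulr_ge0.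
have q0 : 0 <= 1 - w * s ^+ 2 - w * s.
  have E : (1 - w * s ^+ 2 - w * s) * (1 - s) = 1 - s * n.+1%:R.
    rewrite NE -wE; ring.
  by rewrite -(pmulr_lge0 _ (_ : 0 < 1 - s)) ?subr_gt0// E subr_ge0.
apply: (IE_tangent (s := s) (s2 := 1) (p := (1 - w * s ^+ 2 + w * s) / 2)
  (q := (1 - w * s ^+ 2 - w * s) / 2) (w := w)) => //.
- by rewrite tB.
- by right.
- by rewrite -subr_ge0 ltW.
- by rewrite divr_ge0//; lra.
- by rewrite divr_ge0.
- by rewrite NE -wE; field.
- by field.
- by field.
Qed.

(** With [q = 0] the conditions become [p = w * s] and [w * s * (1 + s) = 1]; together with
    [w * (1 - s ^+ 2) = n] they force [s = 1 / n.+1]. *)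
Lemma IE_tangent1 (R : realType) (n : nat) (alpha beta A B tau s : R) :
  0 < A -> 0 < B -> A <= B -> (0 < n)%N ->
  alpha = tau - A -> tau + A <= beta -> s * n.+1%:R = 1 ->
  A * (tau + A * s) = s * B ^+ 2 -> tau * (tau + A * s) + B ^+ 2 = 1 ->
  is_IE (slab n alpha beta) (ellipsoid (diag_ab (A ^- 2) (B ^- 2)) (tau *: e1)).
Proof.
move=> A0 B0 AB n0 tA tB sN T1 T2.
have N1 : 1 < n.+1%:R :> R by rewrite ltr1n.
have NE : n.+1%:R = n%:R + 1 :> R by rewrite natr1.
have N0 : 0 < n.+1%:R :> R by [].
have s0 : 0 < s by rewrite -(pmulr_lgt0 _ N0) sN.
have s1 : s < 1 by rewrite -sN ltr_pMr.
have s21 : 0 < 1 - s ^+ 2.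
  rewrite (_ : 1 - s ^+ 2 = (1 - s) * (1 + s)); last by ring.
  by apply: mulr_gt0; lra.
pose w := n%:R / (1 - s ^+ 2).
have wE : w * (1 - s ^+ 2) = n%:R by rewrite divfK// gt_eqF.
have w0 : 0 <= w by rewrite divr_ge0// ltW.
have ws : w * s ^+ 2 + w * s = 1.
  apply: (mulIf (_ : 1 - s != 0)); first by rewrite subr_eq0 gt_eqF.
  transitivity (s * (w * (1 - s ^+ 2))); first by ring.
  by rewrite wE mul1r -[X in _ = X - _]sN NE; ring.
apply: (IE_tangent (s := s) (s2 := -1) (p := w * s) (q := 0) (w := w)) => //.
- by left.
- by rewrite -subr_ge0 ltW.
- by rewrite mulr_ge0// ltW.
- by rewrite NE -wE addr0 -[X in _ = _ + X]ws; ring.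
- by ring.
- by rewrite addr0 addrC.
Qed.

(** Beyond dimension 1, the ellipsoid spans the full width of the slab when the resulting contact
    height [s] can be at most [1 / N]; otherwise [s] stays at [1 / N] and the ellipsoid leaves the
    plane [x_1 = beta]. *)
Lemma IE_slab (R : realType) (n : nat) (alpha beta : R)
    (h_alpha : -1 <= alpha) (h_lt : alpha < beta) (h_beta : beta <= 1)
    (h_sq : alpha ^+ 2 <= beta ^+ 2) :
  exists a b tau : R, [/\ 0 < a, 0 < b,
    is_IE (slab n alpha beta) (ellipsoid (diag_ab a b) (tau *: e1)) &
    alpha = - beta -> tau = 0].
Proof.
have sigma0 : 0 <= alpha + beta.
  by rewrite -(pmulr_rge0 _ (_ : 0 < beta - alpha)) ?subr_gt0//; nra.
suff [A [B [tau [A0 B0 IE tau0]]]] : exists A B tau : R, [/\ 0 < A, 0 < B,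
    is_IE (slab n alpha beta) (ellipsoid (diag_ab (A ^- 2) (B ^- 2)) (tau *: e1)) &
    alpha = - beta -> tau = 0].
  by exists (A ^- 2), (B ^- 2), tau; split; rewrite ?invr_gt0 ?exprn_gt0.
pose d := (beta - alpha) / 2.
have d0 : 0 < d by rewrite divr_gt0// subr_gt0.
pose t0 := (alpha + beta) / 2.
have alphaE : alpha = t0 - d by rewrite /t0 /d; field.
have betaE : beta = t0 + d by rewrite /t0 /d; field.
have [n0|n0] := posnP n.
  exists d, 1, t0; split=> //; first exact: IE_segment.
  by rewrite /t0 => ->; rewrite addNr mul0r.
set N : R := n.+1%:R.
have N0 : 0 < N by [].
have N1 : 1 < N by rewrite /N ltr1n.
have [s0|s0] := eqVneq (alpha + beta) 0.
  (* By symmetry the contact circle is the equator, so [s = 0] and [B = 1]. *)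
  have tE : t0 = 0 by rewrite /t0 s0 mul0r.
  exists d, 1, 0; split=> //.
  apply: (IE_tangent2 (s := 0)) => //.
  - by move: betaE; rewrite tE; lra.
  - by rewrite alphaE tE.
  - by rewrite betaE tE.
  - by ring.
  - by ring.
have {s0 sigma0} sigma0 : 0 < alpha + beta by rewrite lt_neqAle eq_sym s0.
have t00 : 0 < t0 by rewrite divr_gt0.
have notsym : alpha = - beta -> False.
  by move=> ab; move: sigma0; rewrite ab addNr ltxx.
have NV : N^-1 * N = 1 by rewrite mulVf// gt_eqF.
have NV0 : 0 < N^-1 by rewrite invr_gt0.
have [le1|gt1] := leP (t0 ^+ 2 + d ^+ 2 + t0 * d * (N + N^-1)) 1.
  pose K := 1 - t0 ^+ 2 - d ^+ 2.
  (* With [A = d] and [tau = t0], the first tangency equation gives [B ^+ 2 = d ^+ 2 + t0 * d / s],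
     and substitution into the second gives [p.[s] = 0]. The case hypothesis says that [p] is
     nonnegative at [1 / N]. *)
  pose p : {poly R} := K%:P * 'X - (t0 * d)%:P * ('X ^+ 2 + 1).
  have pE x : p.[x] = K * x - t0 * d * (x ^+ 2 + 1) by rewrite /p !hornerE.
  have td0 : 0 < t0 * d by rewrite mulr_gt0.
  have p0 : K * 0 - t0 * d * (0 ^+ 2 + 1) = - (t0 * d) by ring.
  have [||s /andP[s0 sN]] := @poly_ivt _ p 0 N^-1; first exact: ltW.
    rewrite !pE; apply/andP; split.
      by rewrite p0 oppr_le0 ltW.
    have -> : K * N^-1 - t0 * d * (N ^- 1 ^+ 2 + 1) =
        N^-1 * (K - t0 * d * (N + N^-1)) by field; rewrite gt_eqF.
    apply: mulr_ge0; first exact: ltW.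
    by rewrite /K; move: le1; set u := t0 * d * _; lra.
  rewrite /root pE => /eqP ps.
  have {}s0 : 0 < s.
    rewrite lt_neqAle s0 andbT; apply/eqP => E; move: ps; rewrite -E.
    by rewrite p0 => /eqP; rewrite oppr_eq0 gt_eqF.
  have KE : K = t0 * d * (s + s^-1).
    apply: (mulIf (lt0r_neq0 s0)); rewrite -[LHS](subrK (t0 * d * (s ^+ 2 + 1))) ps.
    by field; rewrite gt_eqF.
  pose B2 := d ^+ 2 + t0 * d / s.
  have tds : 0 < t0 * d / s by rewrite divr_gt0.
  have B20 : 0 < B2 by rewrite addr_gt0// exprn_gt0.
  have BE : Num.sqrt B2 ^+ 2 = B2 by rewrite sqr_sqrtr// ltW.
  exists d, (Num.sqrt B2), t0; split=> //; rewrite ?sqrtr_gt0//.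
  apply: (IE_tangent2 (s := s)); rewrite ?sqrtr_gt0 ?BE//.
  - rewrite -(ler_pXn2r (n := 2))// ?nnegrE ?sqrtr_ge0 ?(ltW d0)// BE.
    by rewrite lerDl ltW.
  - exact: ltW.
  - by rewrite -ler_pdivlMr// mul1r.
  - by rewrite /B2; field; rewrite gt_eqF.
  - rewrite /B2 -[RHS](subrK (t0 ^+ 2 + d ^+ 2)).
    have -> : 1 - (t0 ^+ 2 + d ^+ 2) = K by rewrite /K; ring.
    by rewrite KE; ring.
(* With [s = 1 / N] and [tau = alpha + A], the first tangency equation gives
   [B ^+ 2 = A ^+ 2 + tau * A * N], and the second becomes [h A = 0]. *)
pose h x := (alpha + x) ^+ 2 + x ^+ 2 + (alpha + x) * x * (N + N^-1) - 1.
pose p : {poly R} := (alpha%:P + 'X) ^+ 2 + 'X ^+ 2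
  + (alpha%:P + 'X) * 'X * (N + N^-1)%:P - 1.
have pE x : p.[x] = h x by rewrite /p /h !hornerE.
have alpha1 : alpha ^+ 2 < 1.
  have : 0 < (1 - alpha) * (1 + alpha) by apply: mulr_gt0; lra.
  lra.
(* A root above [m] makes both [A] and [tau] positive, and [A <= d] keeps [tau + A] below [beta]. At
   either value of [m], [h] equals [alpha ^+ 2 - 1]. *)
pose m := Num.max 0 (- alpha).
have hm : h m < 0.
  rewrite /m /h; case: (leP 0 (- alpha)) => al.
    rewrite (_ : _ - 1 = alpha ^+ 2 - 1) ?subr_lt0//; ring.
  rewrite (_ : _ - 1 = alpha ^+ 2 - 1) ?subr_lt0//; ring.
have hd : 0 < h d.
  have adE : alpha + d = t0 by rewrite alphaE subrK.
  by rewrite /h adE subr_gt0.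
have md : m <= d by rewrite /m ge_max ltW//=; lra.
have [|A /andP[mA Ad]] := @poly_ivt _ p m d md.
  by rewrite !pE (ltW hm) (ltW hd).
rewrite /root pE => /eqP hA.
have {}mA : m < A.
  by rewrite lt_neqAle mA andbT; apply/eqP => E; move: hm; rewrite E hA ltxx.
have [A0 aA] : 0 < A /\ - alpha < A.
  by move: mA; rewrite /m gt_max => /andP[].
pose tau := alpha + A.
have tau0 : 0 < tau by rewrite /tau; lra.
pose B2 := A ^+ 2 + tau * A * N.
have tAN : 0 < tau * A * N by rewrite !mulr_gt0.
have B20 : 0 < B2 by rewrite addr_gt0// exprn_gt0.
have BE : Num.sqrt B2 ^+ 2 = B2 by rewrite sqr_sqrtr// ltW.
exists A, (Num.sqrt B2), tau; split=> //; rewrite ?sqrtr_gt0//.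
apply: (IE_tangent1 (s := N^-1)); rewrite ?sqrtr_gt0 ?BE//.
- rewrite -(ler_pXn2r (n := 2))// ?nnegrE ?sqrtr_ge0 ?(ltW A0)// BE.
  by rewrite lerDl ltW.
- by rewrite /tau addrK.
- by rewrite /tau; lra.
- by rewrite /B2; field; rewrite gt_eqF.
- by rewrite -[RHS](addr0 1) -hA /h /B2 /tau; ring.
Qed.

Theorem lemma5p3 (R : realType) (n : nat) (alpha beta : R)
    (h_alpha : -1 <= alpha) (h_lt : alpha < beta) (h_beta : beta <= 1)
    (h_sq : alpha ^+ 2 <= beta ^+ 2) :
  (exists (X : 'M[R]_n.+1) (c : 'cV[R]_n.+1),
    [/\ is_CE (slab n alpha beta) (ellipsoid X c),
        exists a b tau : R,
          [/\ 0 < a, 0 < b, X = diag_ab a b & c = tau *: e1] &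
        alpha = - beta -> c = 0]) /\
  (exists (X : 'M[R]_n.+1) (c : 'cV[R]_n.+1),
    [/\ is_IE (slab n alpha beta) (ellipsoid X c),
        exists a b tau : R,
          [/\ 0 < a, 0 < b, X = diag_ab a b & c = tau *: e1] &
        alpha = - beta -> c = 0]).
Proof.
split.
  have [a [b [tau [a0 b0 CE tau0]]]] := CE_slab n h_alpha h_lt h_beta h_sq.
  exists (diag_ab a b), (tau *: e1); split=> //; first by exists a, b, tau.
  by move/tau0->; rewrite scale0r.
have [a [b [tau [a0 b0 IE tau0]]]] := IE_slab n h_alpha h_lt h_beta h_sq.
exists (diag_ab a b), (tau *: e1); split=> //; first by exists a, b, tau.
by move/tau0->; rewrite scale0r.
Qed.
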